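(* For every $\overline{d}\in(1/2,1]$ and every $\underline{d}\in(1/3,8/15]$ there are $\overline{\alpha},\underline{\alpha}\in(0,1/2)$ such that $$\limsup_{r\to0^+}\mathrm{det}_\infty^{f_{\overline{\alpha}}}(r)=\overline{d}\qquad\text{and}\qquad\liminf_{r\to0^+}\mathrm{det}_\infty^{f_{\underline{\alpha}}}(r)=\underline{d}.$$
   Context: For $\alpha\in(0,1/2)$ the continuous map $f_\alpha:[0,1]\to[0,1]$ is defined by: $f_\alpha(x)=x-1+2\alpha^{j-1}-\alpha^j$ for $x\in[1-\alpha^{j-1},1-\alpha^{j-1}+\alpha^j]$, $j\ge1$; $f_\alpha(x)=\frac{1-\alpha+\alpha^2}{2\alpha-1}(x-1)+\alpha^{j+1}\frac{2-\alpha}{2\alpha-1}$ for $x\in(1-\alpha^{j-1}+\alpha^j,1-\alpha^j)$, $j\ge1$; and $f_\alpha(1)=0$. For a word $u=u_1\dots u_k\in\{0,1\}^k$ put $\kappa(u)=(1-\alpha)\sum_{i=1}^k u_i\alpha^{i-1}$ and $I_\alpha(u)=[\kappa(u),\kappa(u)+\alpha^k]$. The measure $\mu_\alpha$ is the unique Borel probability measure on $[0,1]$ with $\mu_\alpha(I_\alpha(u))=2^{-k}$ for all $k\ge1$ and $u\in\{0,1\}^k$; it is $f_\alpha$-ergodic with support $X_\alpha=\bigcap_{k\ge1}\bigcup_{u\in\{0,1\}^k}I_\alpha(u)$. For $1\le\ell\le\infty$ put $\varrho_\ell(x,y)=\sup\{|f_\alpha^i(x)-f_\alpha^i(y)| :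 0\le i<\ell\}$ and $\mathrm{c}_\ell^{f_\alpha}(r)=\mu_\alpha\times\mu_\alpha\{(x,y):\varrho_\ell(x,y)\le r\}$ for $r>0$. The $\infty$-asymptotic determinism is $\mathrm{det}_\infty^{f_\alpha}(r)=\mathrm{c}_\infty^{f_\alpha}(r)/\mathrm{c}_1^{f_\alpha}(r)$. *)

(* Defs.v *)
From mathcomp Require Import all_boot all_order all_algebra.
From mathcomp Require Import all_classical all_reals all_analysis.
From mathcomp Require Import ring lra.
Import Order.TTheory GRing.Theory Num.Theory.
Import numFieldNormedType.Exports.

Set Implicit Arguments.
Unset Strict Implicit.
Unset Printing Implicit Defensive.

Local Open Scope classical_set_scope.
Local Open Scope ring_scope.

(* The pieces of the map are indexed by [j >= 1] and live on the intervals
   [1 - a^(j-1), 1 - a^j[, which partition [0, 1[ when [0 < a < 1]. *)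
Definition level (R : realType) (a x : R) : nat :=
  xget 0%N [set j | (0 < j)%N /\ x \in `[1 - a ^+ j.-1, 1 - a ^+ j[].

(* Only the values on [0, 1] are meaningful: [fmap] is 0 at 1 by definition,
   and set to 0 outside [0, 1] to be a total function.  The three defining
   clauses are [fmap_left], [fmap_right] and [fmap1] below. *)
Definition fmap (R : realType) (a x : R) : R :=
  if x \in `[0, 1[ then
    let j := level a x in
    if x <= 1 - a ^+ j.-1 + a ^+ j then x - 1 + 2 * a ^+ j.-1 - a ^+ j
    else (1 - a + a ^+ 2) / (2 * a - 1) * (x - 1)
         + a ^+ j.+1 * ((2 - a) / (2 * a - 1))
  else 0.

Lemma levelE (R : realType) (a : R) j x : 0 < a < 1 / 2 -> (0 < j)%N ->
  x \in `[1 - a ^+ j.-1, 1 - a ^+ j[ -> level a x = j.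
Proof.
move=> /andP[a0 a1] j0 xj; rewrite /level; case: xgetP => [k _ [k0 xk]|/(_ j)].
  have key m n : (0 < n)%N -> x \in `[1 - a ^+ m.-1, 1 - a ^+ m[ ->
      x \in `[1 - a ^+ n.-1, 1 - a ^+ n[ -> (n <= m)%N.
    rewrite !in_itv/= => n0 /andP[_ xm] /andP[xn _]; rewrite leqNgt.
    apply/negP => mn; suff: a ^+ n.-1 <= a ^+ m by lra.
    by apply: ler_wiXn2l; [lra|lra|rewrite -ltnS prednK].
  by apply/eqP; rewrite eqn_leq (key j k) // (key k j).
by case.
Qed.

Lemma level_itv (R : realType) (a : R) j x : 0 < a < 1 / 2 -> (0 < j)%N ->
  x \in `[1 - a ^+ j.-1, 1 - a ^+ j[ -> x \in `[0, 1[.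
Proof.
move=> /andP[a0 a1] j0; rewrite !in_itv/= => /andP[xl xr].
have aj1 : a ^+ j.-1 <= 1 by apply: exprn_ile1; lra.
by have aj0 := exprn_gt0 j a0; apply/andP; split; lra.
Qed.

Lemma fmap_left (R : realType) (a : R) j x : 0 < a < 1 / 2 -> (0 < j)%N ->
  x \in `[1 - a ^+ j.-1, 1 - a ^+ j.-1 + a ^+ j] ->
  fmap a x = x - 1 + 2 * a ^+ j.-1 - a ^+ j.
Proof.
move=> a01 j0; rewrite in_itv/= => /andP[xl xr].
have xj : x \in `[1 - a ^+ j.-1, 1 - a ^+ j[.
  rewrite in_itv/= xl/=; apply: (le_lt_trans xr); move/andP: a01 => [a0 a1].
  have aj := exprn_gt0 j.-1 a0.
  have aj' : a ^+ j < a ^+ j.-1 / 2.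
    by rewrite -[in ltLHS](prednK j0) exprSr ltr_pM2l//; lra.
  lra.
by rewrite /fmap (level_itv a01 j0 xj) (levelE a01 j0 xj) /= xr.
Qed.

Lemma fmap_right (R : realType) (a : R) j x : 0 < a < 1 / 2 -> (0 < j)%N ->
  x \in `]1 - a ^+ j.-1 + a ^+ j, 1 - a ^+ j[ ->
  fmap a x = (1 - a + a ^+ 2) / (2 * a - 1) * (x - 1)
             + a ^+ j.+1 * ((2 - a) / (2 * a - 1)).
Proof.
move=> a01 j0; rewrite in_itv/= => /andP[xl xr].
have xj : x \in `[1 - a ^+ j.-1, 1 - a ^+ j[.
  move/andP: a01 => [a0 a1]; have := exprn_gt0 j a0.
  by rewrite in_itv/= xr andbT; lra.
by rewrite /fmap (level_itv a01 j0 xj) (levelE a01 j0 xj) /= leNgt xl.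
Qed.

Lemma fmap1 (R : realType) (a : R) : fmap a 1 = 0.
Proof. by rewrite /fmap in_itv/= ltxx andbF. Qed.

(* Words are 0-indexed: letter [i] has weight [a ^+ i]. *)
Definition kappa (R : realType) (a : R) (k : nat) (u : k.-tuple bool) : R :=
  (1 - a) * \sum_(i < k) (tnth u i)%:R * a ^+ i.

Definition cylinder (R : realType) (a : R) (k : nat) (u : k.-tuple bool)
  : set R := `[kappa a u, kappa a u + a ^+ k].

(* A Borel probability measure on [0, 1] is represented by one on R that gives
   [0, 1] full mass; the two conditions determine it when [0 < a < 1/2]. *)
Definition cylinder_uniform (R : realType) (a : R)
    (mu : probability (measurableTypeR R) R) : Prop :=
  mu [set` `[(0 : R), 1]] = 1%E /\
  forall (k : nat) (u : k.-tuple bool), (0 < k)%N ->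
    mu (cylinder a u) = ((2 ^+ k)^-1)%:E.

(* The length [l] may be [+oo]. *)
Definition rho (R : realType) (a : R) (l : \bar R) (x y : R) : \bar R :=
  ereal_sup [set `|iter i (fmap a) x - iter i (fmap a) y|%:E
            | i in [set i : nat | (i%:R%:E < l)%E]].

Definition corr (R : realType) (a : R)
    (mu : probability (measurableTypeR R) R) (l : \bar R) (r : R) : R :=
  fine ((mu \x mu)%E [set xy : R * R |
    [/\ xy.1 \in `[0, 1], xy.2 \in `[0, 1] &
        (rho a l xy.1 xy.2 <= r%:E)%E]]).

Definition det_infty (R : realType) (a : R)
    (mu : probability (measurableTypeR R) R) (r : R) : R :=
  corr a mu +oo%E r / corr a mu 1%E r.

(* Main.v *)
(* The idea.  On the Cantor set the map is the dyadic odometer.  Code a point by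
   its word read as an integer modulo 2^k, first letter = lowest bit, and let
   K(n) be the left endpoint of the cylinder of n.  K is subadditive with
   K(0) = 0, so along the orbits of the cylinders of m and n the largest value
   of |K(m+i) - K(n+i)| is max (K(m-n), K(n-m)).  Up to an error 2 / 2^k,
   uniformly in r, both correlation sums are therefore averages over words:
   c_1(r) is the proportion of pairs with |K(m) - K(n)| <= r, and c_infty(r) the
   proportion of d with K(d) <= r and K(-d) <= r.  Splitting off the first
   letter gives c(a r) = c(r) / 2 for small r, so det_infty is invariant under
   r -> a r near 0 and its limsup and liminf are a supremum and an infimum over
   an interval ]0, r0].  These depend continuously on a.  At a = 1/4 the
   supremum is at least 1 and the infimum at least 8/15; as a -> 1/2, K becomes
   equidistributed, c_1(r) ~ 2 r, and they tend to 1/2 and 1/3 or below.  The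
   intermediate value theorem concludes. *)
Require Import Defs.
From HB Require Import structures.
From mathcomp Require Import all_boot all_order all_algebra.
From mathcomp Require Import all_classical all_reals all_analysis.
From mathcomp Require Import measurable_realfun.
From mathcomp Require Import ring lra zify.
Import Order.TTheory GRing.Theory Num.Theory.
Import numFieldNormedType.Exports.
Import Defs.
Set Implicit Arguments.
Unset Strict Implicit.
Unset Printing Implicit Defensive.
Local Open Scope classical_set_scope.
Local Open Scope ring_scope.

(** * Codes of words and averages over words *)

(** The counts jump in r, so continuity in a cannot be read off from each count. A change of a is
    traded for a shift of r: codes move by at most 2|a - b| whatever the rank, and a shift of r by
    a^k costs only O(2^-k), because a window of length a^k holds at most one left endpoint. The
    other obstacle is that exact scaling of c_1 needs a r < 1 - 2a, a range that closes up as a ->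
    1/2. However, c_infty scales exactly from all of ]0, 1], and c_1(a r) >= c_1(r) / 2 always
    holds; this is enough to carry upper bounds on the quotient down from scale 1. The extreme
    values come from the plateau of c_infty at 1/2. For a = 1/4 and r = 1/3 both sums equal 1/2. As
    a -> 1/2, c_infty stays at most 1/2 up to r = 3/4, while c_1 carried down from there behaves
    like 2 r = 3/2; hence 1/3. *)

Lemma int_parity (n : int) : exists (q : int) (b : bool), n = q * 2 + b%:Z.
Proof.
exists (n %/ 2)%Z.
have [h|h] : (n %% 2)%Z = 0 \/ (n %% 2)%Z = 1 by lia.
  by exists false; rewrite {1}(divz_eq n 2) h.
by exists true; rewrite {1}(divz_eq n 2) h.
Qed.

Section Code.
Variable R : realFieldType.
Implicit Types (a b s t : R) (k : nat) (m n d q : int).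

(* The left endpoint of the cylinder whose word consists of the k lowest binary
   digits of n, lowest first; n |-> n + 1 is the odometer. *)
Fixpoint code a k n : R :=
  if k is k'.+1 then (n %% 2)%Z%:~R * (1 - a) + a * code a k' (n %/ 2)%Z else 0.

Lemma codeS a k q (b : bool) :
  code a k.+1 (q * 2 + b%:Z) = b%:R * (1 - a) + a * code a k q.
Proof.
have -> : code a k.+1 (q * 2 + b%:Z) = ((q * 2 + b%:Z) %% 2)%Z%:~R * (1 - a)
   + a * code a k ((q * 2 + b%:Z) %/ 2)%Z by [].
have -> : ((q * 2 + b%:Z) %/ 2)%Z = q by case: b; lia.
have -> : ((q * 2 + b%:Z) %% 2)%Z = b%:Z by case: b; lia.
by case: b.
Qed.

Lemma code_even a k q : code a k.+1 (q * 2) = a * code a k q.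
Proof. by rewrite -[q * 2]addr0 (codeS a k q false) mul0r add0r. Qed.

Lemma code_odd a k q : code a k.+1 (q * 2 + 1) = 1 - a + a * code a k q.
Proof. by rewrite (codeS a k q true) mul1r. Qed.

Lemma code0 a k : code a k 0 = 0.
Proof. by elim: k => //= k IH; rewrite mod0z div0z IH mul0r mulr0 addr0. Qed.

Lemma code1 a k : 0 <= a <= 1 -> code a k 1 <= 1 - a.
Proof.
case: k => [|k] a01; first by rewrite /=; lra.
by have := code_odd a k 0; rewrite code0 mulr0 addr0 mul0r add0r /= => ->.
Qed.

Lemma code_ge0 a k n : 0 <= a <= 1 -> 0 <= code a k n.
Proof.
move=> a01; elim: k n => [|k IH] n //.
have [q [b ->]] := int_parity n; rewrite codeS.
have := IH q; case: b => /=; nra.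
Qed.

Lemma code_le a k n : 0 <= a <= 1 -> code a k n <= 1 - a ^+ k.
Proof.
move=> a01; elim: k n => [|k IH] n; first by rewrite expr0 subrr.
have [q [b ->]] := int_parity n; rewrite codeS exprS.
have := IH q; case: b => /=; nra.
Qed.

Lemma code_le1 a k n : 0 <= a <= 1 -> code a k n <= 1.
Proof.
move=> a01; have := code_le k n a01.
have : 0 <= a ^+ k by apply: exprn_ge0; lra.
lra.
Qed.

(** Induction on the lowest digits. Only two odd numbers produce a carry: it costs at most
    [a * (1 - a)] through [code a k 1], and the two letters 1 that disappear pay [2 * (1 - a)]. *)
Lemma codeD a k m n : 0 <= a <= 1 -> code a k (m + n) <= code a k m + code a k n.
Proof.
move=> a01; elim: k m n => [|k IH] m n; first by rewrite /= addr0.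
have [p [b ->]] := int_parity m; have [q [c ->]] := int_parity n.
rewrite !codeS; case: b; case: c.
- have -> : p * 2 + true%:Z + (q * 2 + true%:Z) = (p + (q + 1)) * 2 by rewrite /=; ring.
  rewrite code_even; rewrite /=.
  have h : code a k (p + (q + 1)) <= code a k p + code a k q + (1 - a).
    have := IH p (q + 1); have := IH q 1; have := code1 k a01; lra.
  have a0 : 0 <= a by lra.
  have := ler_wpM2l a0 h; have : 0 <= (1 - a) * (2 - a) by apply: mulr_ge0; lra.
  lra.
- have -> : p * 2 + true%:Z + (q * 2 + false%:Z) = (p + q) * 2 + 1 by rewrite /=; ring.
  by rewrite code_odd; have := IH p q; rewrite /=; nra.
- have -> : p * 2 + false%:Z + (q * 2 + true%:Z) = (p + q) * 2 + 1 by rewrite /=; ring.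
  by rewrite code_odd; have := IH p q; rewrite /=; nra.
- have -> : p * 2 + false%:Z + (q * 2 + false%:Z) = (p + q) * 2 by rewrite /=; ring.
  by rewrite code_even; have := IH p q; rewrite /=; nra.
Qed.

Lemma code_periodic a k n : code a k (n + 2 ^+ k) = code a k n.
Proof.
elim: k n => [//|k IH] n; have [q [b ->]] := int_parity n.
have -> : q * 2 + b%:Z + 2 ^+ k.+1 = (q + 2 ^+ k) * 2 + b%:Z by rewrite exprS; ring.
by rewrite !codeS IH.
Qed.

(** The error obeys e' <= |a - b| + a e, and for a <= 1/2 the bound 2|a - b| is stable under this
    recursion; so it does not depend on k. *)
Lemma code_lip a b k n : 0 <= a <= 1 / 2 -> 0 <= b <= 1 ->
  `|code a k n - code b k n| <= 2 * `|a - b|.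
Proof.
move=> a0 b0; elim: k n => [|k IH] n; first by rewrite subrr normr0 mulr_ge0.
have [q [c ->]] := int_parity n; rewrite !codeS.
have -> : c%:R * (1 - a) + a * code a k q - (c%:R * (1 - b) + b * code b k q)
  = (a - b) * (code b k q - c%:R) + a * (code a k q - code b k q) by ring.
apply: (le_trans (ler_normD _ _)); rewrite !normrM.
have h1 : `|code b k q - c%:R| <= 1.
  have := code_ge0 k q b0; have := code_le1 k q b0.
  by rewrite ler_norml; case: c => /=; lra.
have h2 := IH q; have h3 : `|a| = a by rewrite ger0_norm; lra.
rewrite h3; have := normr_ge0 (a - b); have := normr_ge0 (code a k q - code b k q).
nra.
Qed.

(** At the first letter where the words differ there is a gap proportional to 1 - 2a > 0. Strictness
    makes the closed cylinders of rank k disjoint. *)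
Lemma code_sep a k m n : 0 < a < 1 / 2 -> ~~ (2 ^+ k %| m - n)%Z ->
  a ^+ k < `|code a k m - code a k n|.
Proof.
move=> a0; elim: k m n => [|k IH] m n; first by rewrite expr0 dvd1z.
have [p [b ->]] := int_parity m; have [q [c ->]] := int_parity n.
have a01 : 0 <= a <= 1 by lra.
have ak : 0 < a ^+ k by apply: exprn_gt0; lra.
have := code_ge0 k p a01; have := code_ge0 k q a01.
have := code_le k p a01; have := code_le k q a01.
rewrite !codeS (exprS a); case: b; case: c => /=.
- move=> h1 h2 h3 h4.
  have -> : p * 2 + 1 - (q * 2 + 1) = (p - q) * 2 by ring.
  rewrite exprSr dvdz_mul2r // => /IH.
  have -> : 1 * (1 - a) + a * code a k p - (1 * (1 - a) + a * code a k q)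
    = a * (code a k p - code a k q) by ring.
  by rewrite normrM (@ger0_norm _ a) ?ltr_pM2l; lra.
- by move=> h1 h2 h3 h4 _; rewrite ger0_norm; nra.
- by move=> h1 h2 h3 h4 _; rewrite ler0_norm; nra.
- move=> h1 h2 h3 h4.
  have -> : p * 2 + 0 - (q * 2 + 0) = (p - q) * 2 by ring.
  rewrite exprSr dvdz_mul2r // => /IH.
  have -> : 0 * (1 - a) + a * code a k p - (0 * (1 - a) + a * code a k q)
    = a * (code a k p - code a k q) by ring.
  by rewrite normrM (@ger0_norm _ a) ?ltr_pM2l; lra.
Qed.

(** The mean over 0, ..., 2^k - 1 (see [avgE]), defined through the lowest bit so that it unfolds in
    step with [code]. *)
Fixpoint avg k (f : int -> R) : R :=
  if k is k'.+1 then
    (avg k' (fun q => f (q * 2)) + avg k' (fun q => f (q * 2 + 1))) / 2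
  else f 0.

Lemma avgS k (f : int -> R) : avg k.+1 f =
  (avg k (fun q => f (q * 2)) + avg k (fun q => f (q * 2 + 1))) / 2.
Proof. by []. Qed.

Lemma avg_le k (f g : int -> R) : (forall n, f n <= g n) -> avg k f <= avg k g.
Proof.
elim: k f g => [|k IH] f g fg /=; first exact: fg.
by rewrite ler_wpM2r ?lerD ?IH//; lra.
Qed.

Lemma eq_avg k (f g : int -> R) : f =1 g -> avg k f = avg k g.
Proof. by move=> fg; apply/le_anti; rewrite !avg_le// => n; rewrite fg. Qed.

Lemma avgD k (f g : int -> R) : avg k (fun n => f n + g n) = avg k f + avg k g.
Proof. by elim: k f g => //= k IH f g; rewrite !IH; field. Qed.

Lemma avgZ k (c : R) (f : int -> R) : avg k (fun n => c * f n) = c * avg k f.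
Proof. by elim: k f => //= k IH f; rewrite !IH; field. Qed.

Lemma avg_cst k (c : R) : avg k (fun=> c) = c.
Proof. by elim: k => //= k ->; field. Qed.

Lemma avgE k (f : int -> R) : avg k f = (2 ^+ k)^-1 * \sum_(n < 2 ^ k) f n%:Z.
Proof.
have sum2 N (g : int -> R) : \sum_(0 <= n < N * 2) g n%:Z =
    \sum_(0 <= n < N) g (n%:Z * 2) + \sum_(0 <= n < N) g (n%:Z * 2 + 1).
  elim: N => [|N IH]; first by rewrite !big_geq // addr0.
  rewrite mulSn add2n !big_nat_recr //= IH !PoszM.
  have -> : (N * 2).+1%:Z = N%:Z * 2 + 1 by lia.
  ring.
elim: k f => [|k IH] f; first by rewrite expr0 invr1 mul1r big_ord1.
rewrite /= !IH -(big_mkord xpredT (fun n : nat => f n%:Z)) expnSr sum2 exprS.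
rewrite !big_mkord.
have : (2 ^+ k : R) != 0 by rewrite expf_neq0 ?pnatr_eq0.
by move=> h; field.
Qed.

(** Adding 1 exchanges the parities: q * 2 becomes q * 2 + 1, and q * 2 + 1 becomes (q + 1) * 2,
    which is the induction hypothesis for the even half. *)
Lemma avg_succ k (f : int -> R) : (forall n, f (n + 2 ^+ k) = f n) ->
  avg k (fun n => f (n + 1)) = avg k f.
Proof.
elim: k f => [|k IH] f fP /=; first by rewrite fP.
congr (_ / 2); rewrite addrC; congr (_ + _).
under eq_avg => q do [have -> : q * 2 + 1 + 1 = (q + 1) * 2 by ring].
apply: (IH (fun q => f (q * 2))) => n.
by rewrite -[RHS]fP exprSr mulrDl.
Qed.

Lemma avg_shift k (f : int -> R) (m : nat) : (forall n, f (n + 2 ^+ k) = f n) ->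
  avg k (fun n => f (n - m%:Z)) = avg k f.
Proof.
move=> fP; elim: m => [|m <-]; first by under eq_avg do rewrite subr0.
rewrite -avg_succ => [|n]; last by rewrite addrAC fP.
by apply: eq_avg => n; congr f; lia.
Qed.

(** The reflection n -> -1 - n flips every binary digit, so it respects the splitting by lowest bit;
    negation is this reflection followed by a shift. *)
Lemma avg_rev k (f : int -> R) : (forall n, f (n + 2 ^+ k) = f n) ->
  avg k (fun n => f (-1 - n)) = avg k f.
Proof.
elim: k f => [|k IH] f fP /=.
  by rewrite subr0 -[LHS]fP expr0 addNr.
congr (_ / 2); rewrite addrC; congr (_ + _).
- under eq_avg => q do [have -> : -1 - (q * 2 + 1) = (-1 - q) * 2 by ring].
  apply: (IH (fun q => f (q * 2))) => n; by rewrite -[RHS]fP exprSr mulrDl.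
- under eq_avg => q do [have -> : -1 - q * 2 = (-1 - q) * 2 + 1 by ring].
  apply: (IH (fun q => f (q * 2 + 1))) => n.
  by rewrite -[RHS]fP exprSr mulrDl addrAC.
Qed.

Lemma avg_opp k (f : int -> R) : (forall n, f (n + 2 ^+ k) = f n) ->
  avg k (fun n => f (- n)) = avg k f.
Proof.
move=> fP; rewrite -(avg_rev fP) -[LHS]avg_succ; last first.
  by move=> n; rewrite -[LHS]fP opprD subrK.
by apply: eq_avg => n; congr f; ring.
Qed.
End Code.

(** * Proportions of words and the window estimate *)

Section Counts.
Variable R : realFieldType.
Implicit Types (a b s t : R) (k : nat) (m n d q : int).

Lemma avgB k (f g : int -> R) : avg k (fun n => f n - g n) = avg k f - avg k g.
Proof.
rewrite (@eq_avg _ _ _ (fun n => f n + -1 * g n)) => [|n]; last by rewrite mulN1r.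
by rewrite avgD avgZ mulN1r.
Qed.

Lemma avg_ge0 k (f : int -> R) : (forall n, 0 <= f n) -> 0 <= avg k f.
Proof. by move=> f0; rewrite -[leLHS](avg_cst k) avg_le. Qed.

Lemma avg_le1 k (f : int -> R) : (forall n, f n <= 1) -> avg k f <= 1.
Proof. by move=> f1; rewrite -[leRHS](avg_cst k) avg_le. Qed.

Lemma avg_ge_at0 k (f : int -> R) : (forall n, 0 <= f n) ->
  f 0 / 2 ^+ k <= avg k f.
Proof.
elim: k f => [|k IH] f f0 /=; first by rewrite expr0 divr1.
rewrite exprSr invfM mulrA ler_wpM2r ?invr_ge0 ?ler0n//.
rewrite -[leLHS]addr0 lerD ?avg_ge0//.
by have := IH (fun q => f (q * 2)); rewrite mul0r; apply => q.
Qed.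

Lemma avg_exchange j k (f : int -> int -> R) :
  avg j (fun m => avg k (fun n => f m n)) = avg k (fun n => avg j (fun m => f m n)).
Proof.
elim: j f => [|j IH] f //=; rewrite !IH -avgD.
rewrite [RHS](@eq_avg _ _ _ (fun n => 2^-1 *
  (avg j (fun m => f (m * 2) n) + avg j (fun m => f (m * 2 + 1) n)))).
  by rewrite avgZ mulrC.
by move=> n; rewrite mulrC.
Qed.

Lemma avg_shiftz k (f : int -> R) m : (forall n, f (n + 2 ^+ k) = f n) ->
  avg k (fun n => f (n - m)) = avg k f.
Proof.
move=> fP; case: m => m; first exact: avg_shift.
have := @avg_shift _ k (fun n => f (n + m.+1%:Z)) m.+1.
move=> <- => [|n]; last by rewrite addrAC fP.
by apply: eq_avg => n; rewrite subrK.
Qed.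

(** The difference of two independent uniform residues is uniform: this turns a count of pairs
    depending on m - n into a count of single words. *)
Lemma avg_diff k (f : int -> R) : (forall n, f (n + 2 ^+ k) = f n) ->
  avg k (fun m => avg k (fun n => f (m - n))) = avg k f.
Proof.
move=> fP; rewrite avg_exchange -[RHS](avg_cst k).
by apply: eq_avg => n; exact: avg_shiftz.
Qed.

Definition bound_count a k t : R := avg k (fun n => (code a k n <= t)%R%:R).

Definition pair_count a k t : R :=
  avg k (fun m => avg k (fun n => (`|code a k m - code a k n| <= t)%R%:R)).

Definition orbit_count a k t : R :=
  avg k (fun d => ((code a k d <= t) && (code a k (- d) <= t))%R%:R).

Lemma ler_indic (P Q : bool) : (P -> Q) -> (P%:R <= Q%:R :> R).
Proof. by case: P; case: Q => // /(_ isT). Qed.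

(** A half-open window of length a^k holds at most one left endpoint, also at a = 1/2, where the
    endpoints are exactly a^k apart. *)
Lemma avg_window a k s : 0 < a <= 1 / 2 ->
  avg k (fun n => (s < code a k n <= s + a ^+ k)%R%:R) <= (2 ^+ k)^-1 :> R.
Proof.
move=> a0; have a01 : 0 <= a <= 1 by lra.
elim: k s => [|k IH] s; first by rewrite expr0 invr1 /=; case: (_ && _).
have ak : 0 < a ^+ k by apply: exprn_gt0; lra.
rewrite avgS [2 ^+ _]exprSr invfM ler_wpM2r ?invr_ge0 ?ler0n//.
under eq_avg do rewrite code_even.
under [X in _ + X]eq_avg do rewrite code_odd.
have a_gt0 : 0 < a by lra.
(* The threshold is the largest even code. Below it the window ends before the odd codes begin;
   above it the window misses the even ones. Either way one half survives and is rescaled by a. *)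
have [sa|sa] := ltP s (a * (1 - a ^+ k)).
  rewrite [X in _ + X](@eq_avg _ _ _ (fun=> 0)) => [|q].
    rewrite avg_cst addr0; apply: le_trans (IH (s / a)).
    apply: avg_le => q; apply: ler_indic; rewrite exprS => /andP[h1 h2].
    by rewrite ltr_pdivrMr// -lerBlDr ler_pdivlMr//; apply/andP; split; lra.
  have := code_ge0 k q a01 => h.
  case: (boolP (_ && _)) => // /andP[_]; rewrite exprS => h2; exfalso.
  have : 0 <= a * code a k q by apply: mulr_ge0; lra.
  lra.
rewrite [X in X + _](@eq_avg _ _ _ (fun=> 0)) => [|q].
  rewrite avg_cst add0r; apply: le_trans (IH ((s - 1 + a) / a)).
  apply: avg_le => q; apply: ler_indic; rewrite exprS => /andP[h1 h2].
  by rewrite ltr_pdivrMr// -lerBlDr ler_pdivlMr//; apply/andP; split; lra.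
have := code_le k q a01; rewrite -(ler_pM2l a_gt0) => h.
by case: (boolP (_ && _)) => // /andP[h2 _]; exfalso; lra.
Qed.
End Counts.

(** * Counting functions *)

Section CountBounds.
Variable R : realFieldType.
Implicit Types (a b s t : R) (k : nat) (m n d q : int).

Lemma ler_indicD (P Q S : bool) : (P -> Q || S) -> (P%:R <= Q%:R + S%:R :> R).
Proof.
case: P => /= [/(_ isT)|_]; last by rewrite addr_ge0.
by case: Q; case: S => //= _; lra.
Qed.

Lemma le_bound_count a k s t : s <= t -> bound_count a k s <= bound_count a k t.
Proof. by move=> st; apply: avg_le => n; apply: ler_indic => /le_trans; apply. Qed.

Lemma le_pair_count a k s t : s <= t -> pair_count a k s <= pair_count a k t.
Proof.
by move=> st; do 2![apply: avg_le => ?]; apply: ler_indic => /le_trans; apply.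
Qed.

Lemma le_orbit_count a k s t : s <= t -> orbit_count a k s <= orbit_count a k t.
Proof.
move=> st; apply: avg_le => n; apply: ler_indic => /andP[h1 h2].
by rewrite (le_trans h1) ?(le_trans h2).
Qed.

Lemma bound_count_step a k s : 0 < a <= 1 / 2 ->
  bound_count a k (s + a ^+ k) <= bound_count a k s + (2 ^+ k)^-1.
Proof.
move=> a0; apply: le_trans (lerD (lexx _) (avg_window k s a0)).
rewrite -avgD; apply: avg_le => n; apply: ler_indicD => ->.
by rewrite andbT; case: leP.
Qed.

(** In a pair gained, one code lies in the window of length a^k starting at distance s above the
    other; each of the two orders costs 2^-k. *)
Lemma pair_count_step a k s : 0 < a <= 1 / 2 ->
  pair_count a k (s + a ^+ k) <= pair_count a k s + 2 / 2 ^+ k.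
Proof.
move=> a0; pose w m n : R := (s + code a k n < code a k m <= s + code a k n + a ^+ k)%R%:R.
have w_le n : avg k (fun m => w m n) <= (2 ^+ k)^-1 by exact: avg_window.
apply: (@le_trans _ _ (pair_count a k s + (avg k (fun m => avg k (w m)) +
    avg k (fun m => avg k (fun n => w n m))))).
  rewrite -!avgD; apply: avg_le => m; rewrite -!avgD; apply: avg_le => n.
  rewrite /w; set x := code a k m; set y := code a k n.
  rewrite !ler_norml; apply: (le_trans (ler_indicD _)); last first.
    by apply: lerD (lexx _) _; apply: ler_indicD; exact: id.
  move=> /andP[h1 h2]; have [h3|h3] := leP (x - y) s; have [h4|h4] := leP (- s) (x - y) => //=.
  - by apply/orP; right; apply/andP; split; lra.
  - by apply/orP; left; apply/andP; split; lra.
  - by apply/orP; left; apply/andP; split; lra.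
rewrite lerD2l (avg_exchange k k w).
have h : avg k (fun n => avg k (fun m => w m n)) <= (2 ^+ k)^-1.
  by rewrite -[leRHS](avg_cst k) avg_le.
lra.
Qed.

Lemma orbit_count_step a k s : 0 < a <= 1 / 2 ->
  orbit_count a k (s + a ^+ k) <= orbit_count a k s + 2 / 2 ^+ k.
Proof.
move=> a0; pose w n : R := (s < code a k n <= s + a ^+ k)%R%:R.
have w_le : avg k w <= (2 ^+ k)^-1 by exact: avg_window.
apply: (@le_trans _ _ (orbit_count a k s + (avg k w + avg k (fun n => w (- n))))).
  rewrite -!avgD; apply: avg_le => m.
  rewrite /w; set x := code a k m; set y := code a k (- m).
  apply: (le_trans (ler_indicD _)); last first.
    by apply: lerD (lexx _) _; apply: ler_indicD; exact: id.
  by move=> /andP[-> ->]; rewrite !andbT; case: leP => //; case: leP.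
rewrite lerD2l avg_opp; first lra.
by move=> n; rewrite /w code_periodic.
Qed.

(** The slack 4|a - b| is that of a difference of two codes, each moving by 2|a - b|; the three
    counts share it. *)
Lemma bound_count_lip a b k t : 0 <= a <= 1 / 2 -> 0 <= b <= 1 / 2 ->
  bound_count a k t <= bound_count b k (t + 4 * `|a - b|).
Proof.
move=> a0 b0; apply: avg_le => n; apply: ler_indic => h.
have := @code_lip _ a b k n a0; rewrite ler_norml => /(_ _)/andP[]; first lra.
by have := normr_ge0 (a - b); lra.
Qed.

Lemma pair_count_lip a b k t : 0 <= a <= 1 / 2 -> 0 <= b <= 1 / 2 ->
  pair_count a k t <= pair_count b k (t + 4 * `|a - b|).
Proof.
move=> a0 b0; apply: avg_le => m; apply: avg_le => n; apply: ler_indic.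
have h p : code b k p - 2 * `|a - b| <= code a k p <= code b k p + 2 * `|a - b|.
  have := @code_lip _ a b k p a0; rewrite ler_norml => /(_ _)/andP[]; first lra.
  by lra.
have /andP[h1 h2] := h m; have /andP[h3 h4] := h n.
by rewrite !ler_norml => /andP[h5 h6]; apply/andP; split; lra.
Qed.

Lemma orbit_count_lip a b k t : 0 <= a <= 1 / 2 -> 0 <= b <= 1 / 2 ->
  orbit_count a k t <= orbit_count b k (t + 4 * `|a - b|).
Proof.
move=> a0 b0; apply: avg_le => n; apply: ler_indic => /andP[h1 h2].
have h p : code b k p <= code a k p + 2 * `|a - b|.
  have := @code_lip _ a b k p a0; rewrite ler_norml => /(_ _)/andP[]; first lra.
  by lra.
have := h n; have := h (- n); have := normr_ge0 (a - b).
by move=> ? ? ?; apply/andP; split; lra.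
Qed.

(** Write the single word d as m - n; subadditivity bounds both signs of K(m) - K(n) by K(m - n) and
    K(n - m). *)
Lemma orbit_le_pair a k t : 0 <= a <= 1 -> orbit_count a k t <= pair_count a k t.
Proof.
move=> a01; rewrite -[leLHS](avg_diff (f := fun d =>
  ((code a k d <= t) && (code a k (- d) <= t))%R%:R)); last first.
  by move=> n; rewrite code_periodic -[in X in _ && X]code_periodic opprD subrK.
apply: avg_le => m; apply: avg_le => n; apply: ler_indic => /andP[h1 h2].
have := codeD k (m - n) n a01; have := codeD k (- (m - n)) m a01.
have -> : - (m - n) + m = n by ring.
by rewrite subrK ler_norml => ? ?; apply/andP; split; lra.
Qed.

Lemma orbit_le_bound a k t : orbit_count a k t <= bound_count a k t.
Proof. by apply: avg_le => n; apply: ler_indic => /andP[]. Qed.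

(** The word d = 0 always counts. This is what keeps the quotient well defined and its denominator
    away from 0. *)
Lemma orbit_count_ge a k t : 0 <= t -> (2 ^+ k)^-1 <= orbit_count a k t.
Proof.
move=> t0; apply: le_trans (avg_ge_at0 _ _) => [|n]; last by rewrite ler0n.
by rewrite oppr0 code0 t0 div1r.
Qed.

Lemma orbit_count_le1 a k t : orbit_count a k t <= 1.
Proof. by apply: avg_le1 => n; case: (_ && _). Qed.

Lemma pair_count_le1 a k t : pair_count a k t <= 1.
Proof. by do 2![apply: avg_le1 => ?]; case: (`|_| <= _). Qed.
End CountBounds.

(** * Recursions from splitting off the first letter *)

Section Recursion.
Variable R : realFieldType.
Implicit Types (a b s t : R) (k : nat) (m n d q : int).

(** The signed count appears when two first letters differ: the sign of the difference is then known
    and the absolute value drops out. *)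
Definition diff_count a k t : R :=
  avg k (fun m => avg k (fun n => (code a k m - code a k n <= t)%R%:R)).

(* The contribution of the odd d = 2e + 1 to [orbit_count], where
   - d = 2(-1 - e) + 1. *)
Definition odd_orbit_count a k t : R :=
  avg k (fun e => ((code a k e <= t) && (code a k (-1 - e) <= t))%R%:R).

Lemma indic_avg0 k (P : int -> bool) : (forall n, ~~ P n) -> avg k (fun n => (P n)%:R) = 0 :> R.
Proof. by move=> P0; rewrite -[RHS](avg_cst k); apply: eq_avg => n; rewrite (negbTE (P0 n)). Qed.

Lemma indic_avg1 k (P : int -> bool) : (forall n, P n) -> avg k (fun n => (P n)%:R) = 1 :> R.
Proof. by move=> P1; rewrite -[RHS](avg_cst k); apply: eq_avg => n; rewrite P1. Qed.

Lemma bound_count0 a k t : 0 <= a <= 1 -> t < 0 -> bound_count a k t = 0.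
Proof.
by move=> a01 t0; apply: indic_avg0 => n; rewrite -ltNge; have := code_ge0 k n a01; lra.
Qed.

Lemma bound_count1 a k t : 0 <= a <= 1 -> 1 <= t -> bound_count a k t = 1.
Proof.
by move=> a01 t1; apply: indic_avg1 => n; have := code_le1 k n a01; lra.
Qed.

Lemma bound_countS a k t : 0 < a <= 1 -> bound_count a k.+1 t =
  (bound_count a k (t / a) + bound_count a k ((t - 1 + a) / a)) / 2.
Proof.
move=> /andP[a0 _]; rewrite /bound_count avgS; congr ((_ + _) / 2); apply: eq_avg => q.
  by rewrite code_even ler_pdivlMr// mulrC.
by rewrite code_odd ler_pdivlMr//; congr (nat_of_bool _)%:R; apply/idP/idP; lra.
Qed.

Lemma diff_countC a k t :
  diff_count a k t = avg k (fun m => avg k (fun n => (code a k n - code a k m <= t)%R%:R)).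
Proof. exact: avg_exchange. Qed.

Lemma avgSS k (f : int -> int -> R) : avg k.+1 (fun m => avg k.+1 (fun n => f m n)) =
  (avg k (fun m => avg k (fun n => f (m * 2) (n * 2)))
  + avg k (fun m => avg k (fun n => f (m * 2) (n * 2 + 1)))
  + avg k (fun m => avg k (fun n => f (m * 2 + 1) (n * 2)))
  + avg k (fun m => avg k (fun n => f (m * 2 + 1) (n * 2 + 1)))) / 4.
Proof.
rewrite avgS.
have e g : avg k (fun m => avg k.+1 (g m)) = 2^-1 * (avg k (fun m => avg k (fun n => g m (n * 2)))
   + avg k (fun m => avg k (fun n => g m (n * 2 + 1)))).
  by rewrite -avgD -avgZ; apply: eq_avg => m; rewrite avgS mulrC.
by rewrite !e; field.
Qed.

(** Equal first letters scale the difference by a. Different ones give 1 - a plus a times a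
    difference in [-1, 1], which is nonnegative because a <= 1/2. *)
Lemma pair_countS a k t : 0 < a <= 1 / 2 -> pair_count a k.+1 t =
  (pair_count a k (t / a) + diff_count a k ((t - 1 + a) / a)) / 2.
Proof.
move=> a0; have a01 : 0 <= a <= 1 by lra.
have ak : 0 <= a ^+ k by apply: exprn_ge0; lra.
have h m n : 0 <= 1 - a + a * (code a k m - code a k n).
  have := code_ge0 k m a01; have := code_le1 k n a01 => h1 h2.
  have : a * (1 + (code a k m - code a k n)) >= 0 by apply: mulr_ge0; lra.
  lra.
rewrite /pair_count avgSS.
set E := avg k _; set E2 := (X in _ + X + _ + _).
set E3 := (X in _ + X + _); set E4 := (X in _ + X).
have a_gt0 : 0 < a by lra.
have e1 : E = pair_count a k (t / a).
  apply: eq_avg => m; apply: eq_avg => n; rewrite !code_even -mulrBr normrM gtr0_norm//.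
  by rewrite ler_pdivlMr// mulrC.
have e4 : E4 = pair_count a k (t / a).
  apply: eq_avg => m; apply: eq_avg => n; rewrite !code_odd opprD addrACA subrr add0r -mulrBr.
  by rewrite normrM gtr0_norm// ler_pdivlMr// mulrC.
have e3 : E3 = diff_count a k ((t - 1 + a) / a).
  apply: eq_avg => m; apply: eq_avg => n; rewrite code_even code_odd -addrA -mulrBr.
  by rewrite ger0_norm// ler_pdivlMr//; congr (nat_of_bool _)%:R; apply/idP/idP; lra.
have e2 : E2 = diff_count a k ((t - 1 + a) / a).
  rewrite diff_countC.
  apply: eq_avg => m; apply: eq_avg => n; rewrite code_even code_odd distrC -addrA -mulrBr.
  by rewrite ger0_norm// ler_pdivlMr//; congr (nat_of_bool _)%:R; apply/idP/idP; lra.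
by rewrite e1 e2 e3 e4 /pair_count; field.
Qed.

Lemma diff_count_ge0 a k t : 0 <= diff_count a k t.
Proof. by do 2![apply: avg_ge0 => ?]; case: (_ - _ <= _). Qed.

(** Three of the four pairs of first letters are bounded trivially by 1/4 each; only the pair (1, 0)
    is followed. *)
Lemma diff_countS_le a k t : 0 < a <= 1 / 2 ->
  diff_count a k.+1 t <= 3 / 4 + diff_count a k ((t - 1 + a) / a) / 4.
Proof.
move=> a0; rewrite /diff_count avgSS.
set E := avg k _; set E2 := (X in _ + X + _ + _).
set E3 := (X in _ + X + _); set E4 := (X in _ + X).
have a_gt0 : 0 < a by lra.
have e1 : E <= 1 by do 2![apply: avg_le1 => ?]; case: (_ - _ <= _).
have e2 : E2 <= 1 by do 2![apply: avg_le1 => ?]; case: (_ - _ <= _).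
have e4 : E4 <= 1 by do 2![apply: avg_le1 => ?]; case: (_ - _ <= _).
have e3 : E3 = diff_count a k ((t - 1 + a) / a).
  apply: eq_avg => m; apply: eq_avg => n; rewrite code_even code_odd -addrA -mulrBr.
  by rewrite ler_pdivlMr//; congr (nat_of_bool _)%:R; apply/idP/idP; lra.
rewrite e3 -/(diff_count _ _ _); lra.
Qed.

(** Add the count to its mirror image: x - y <= t and y - x <= t both hold only if |x - y| <= t. *)
Lemma diff_count_le_pair a k t : diff_count a k t <= (1 + pair_count a k t) / 2.
Proof.
have : diff_count a k t + diff_count a k t
    <= avg k (fun=> avg k (fun=> 1)) + pair_count a k t.
  rewrite {2}diff_countC -!avgD; apply: avg_le => m; rewrite -!avgD.
  apply: avg_le => n; rewrite ler_norml; set x := code a k m; set y := code a k n.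
  have [h1|h1] := leP (x - y) t; have [h2|h2] := leP (y - x) t;
    have [h3|h3] := leP (- t) (x - y); rewrite /=; lra.
rewrite !avg_cst; lra.
Qed.

Lemma orbit_countS a k t : 0 < a <= 1 -> orbit_count a k.+1 t =
  (orbit_count a k (t / a) + odd_orbit_count a k ((t - 1 + a) / a)) / 2.
Proof.
move=> /andP[a0 _]; rewrite /orbit_count avgS; congr ((_ + _) / 2); apply: eq_avg => q.
  by rewrite -mulNr !code_even !ler_pdivlMr// ![_ * a]mulrC.
have -> : - (q * 2 + 1) = (-1 - q) * 2 + 1 by ring.
rewrite !code_odd !ler_pdivlMr//; congr (nat_of_bool (_ && _))%:R; apply/idP/idP; lra.
Qed.

Lemma odd_orbit_count0 a k t : 0 <= a <= 1 -> t < 0 -> odd_orbit_count a k t = 0.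
Proof.
move=> a01 t0; apply: indic_avg0 => n.
by have := code_ge0 k n a01; apply: contraTN => /andP[? _]; rewrite -ltNge; lra.
Qed.

(** One of e and -1 - e is odd, so its code is at least 1 - a. *)
Lemma odd_orbit_countS0 a k t : 0 <= a <= 1 -> t < 1 - a ->
  odd_orbit_count a k.+1 t = 0.
Proof.
move=> a01 ta; apply: indic_avg0 => n; have [q [[] ->]] := int_parity n.
  rewrite code_odd; apply/negP => /andP[h _].
  have := code_ge0 k q a01 => h1; have : 0 <= a * code a k q by apply: mulr_ge0; lra.
  by lra.
have -> : -1 - (q * 2 + false%:Z) = (-1 - q) * 2 + 1 by rewrite /=; ring.
rewrite code_odd; apply/negP => /andP[_ h].
have := code_ge0 k (-1 - q) a01 => h1; have : 0 <= a * code a k (-1 - q) by apply: mulr_ge0; lra.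
by lra.
Qed.

(** For t >= 1 - a, of the two numbers e and -1 - e the even one has code at most a <= t, so only
    the odd one constrains; by reflection both parities of e contribute the same [bound_count]. *)
Lemma odd_orbit_countS_ge a k t : 0 < a <= 1 / 2 ->
  bound_count a k ((t - 1 + a) / a) <= odd_orbit_count a k.+1 t.
Proof.
move=> a0; have a_gt0 : 0 < a by lra. have a01 : 0 <= a <= 1 by lra.
have [t0|t0] := ltP t (1 - a).
  rewrite bound_count0//; last by rewrite ltr_pdivrMr//; lra.
  by apply: avg_ge0 => n; case: (_ && _).
rewrite /odd_orbit_count avgS.
have small q : a * code a k q <= t.
  by have := code_le1 k q a01; have := code_ge0 k q a01; nra.
have e q : (1 - a + a * code a k q <= t) = (code a k q <= (t - 1 + a) / a).
  by rewrite ler_pdivlMr//; apply/idP/idP; lra.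
have h1 : avg k (fun q => ((code a k.+1 (q * 2) <= t) &&
     (code a k.+1 (-1 - q * 2) <= t))%R%:R) = bound_count a k ((t - 1 + a) / a).
  rewrite /bound_count -[RHS]avg_rev => [|n]; last by rewrite code_periodic.
  apply: eq_avg => q; have -> : -1 - q * 2 = (-1 - q) * 2 + 1 by ring.
  by rewrite code_even code_odd small e.
have h2 : avg k (fun q => ((code a k.+1 (q * 2 + 1) <= t) &&
     (code a k.+1 (-1 - (q * 2 + 1)) <= t))%R%:R) = bound_count a k ((t - 1 + a) / a).
  apply: eq_avg => q; have -> : -1 - (q * 2 + 1) = (-1 - q) * 2 by ring.
  by rewrite code_even code_odd small e andbT.
by rewrite h1 h2; lra.
Qed.
End Recursion.

(** * Scaling, comparison of the counts, and the case a = 1/2 *)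

Section Estimates.
Variable R : realFieldType.
Implicit Types (a b s t : R) (k : nat) (m n d q : int).

Lemma diff_count0 a k t : 0 <= a <= 1 -> t < -1 -> diff_count a k t = 0.
Proof.
move=> a01 t1; rewrite /diff_count -[RHS](avg_cst k); apply: eq_avg => m.
apply: indic_avg0 => n; rewrite -ltNge.
by have := code_ge0 k m a01; have := code_le1 k n a01; lra.
Qed.

(** Points with different first letters are at least 1 - 2a apart, so only pairs sharing the first
    letter remain. *)
Lemma pair_count_scale a k t : 0 < a <= 1 / 2 -> a * t < 1 - 2 * a ->
  pair_count a k.+1 (a * t) = pair_count a k t / 2.
Proof.
move=> a0 ta; rewrite pair_countS// diff_count0 ?addr0; last 2 first.
- by lra.
- by rewrite ltr_pdivrMr; lra.
by rewrite [a * t]mulrC mulfK//; lra.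
Qed.

(** There is no smallness condition on t: for a near 1/2 this is the half of the scaling relation
    that survives. *)
Lemma pair_count_scale_ge a k t : 0 < a <= 1 / 2 ->
  pair_count a k t / 2 <= pair_count a k.+1 (a * t).
Proof.
move=> a0; rewrite pair_countS// [a * t]mulrC mulfK; last by lra.
by have := diff_count_ge0 a k ((t * a - 1 + a) / a); lra.
Qed.

Lemma orbit_count_scale a k t : 0 < a <= 1 -> a * t < 1 - a ->
  orbit_count a k.+1 (a * t) = orbit_count a k t / 2.
Proof.
move=> a0 ta; rewrite orbit_countS// odd_orbit_count0 ?addr0; last 2 first.
- by lra.
- by rewrite ltr_pdivrMr; lra.
by rewrite [a * t]mulrC mulfK//; lra.
Qed.

Lemma odd_orbit_count_ge0 a k t : 0 <= odd_orbit_count a k t.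
Proof. by apply: avg_ge0 => n; case: (_ && _). Qed.

Lemma orbit_count_scale_ge a k t : 0 < a <= 1 ->
  orbit_count a k t / 2 <= orbit_count a k.+1 (a * t).
Proof.
move=> a0; rewrite orbit_countS// [a * t]mulrC mulfK; last by lra.
by have := odd_orbit_count_ge0 a k ((t * a - 1 + a) / a); lra.
Qed.

Lemma orbit_count1 a k t : 0 <= a <= 1 -> 1 <= t -> orbit_count a k t = 1.
Proof.
move=> a01 t1; apply: indic_avg1 => n.
have := code_le1 k n a01; have := code_le1 k (- n) a01.
by move=> ? ?; apply/andP; split; lra.
Qed.

Lemma orbit_count_ge_half a k t : 0 < a <= 1 -> a <= t ->
  1 / 2 <= orbit_count a k.+1 t.
Proof.
move=> a0 ta; rewrite orbit_countS// orbit_count1; last 2 first.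
- by lra.
- by rewrite ler_pdivlMr; lra.
by have := odd_orbit_count_ge0 a k ((t - 1 + a) / a); lra.
Qed.

Lemma pair_count_le_half a k t : 0 < a <= 1 / 2 -> t < 1 - 2 * a ->
  pair_count a k.+1 t <= 1 / 2.
Proof.
move=> a0 ta; have e : t = a * (t / a) by rewrite mulrC divfK//; lra.
by rewrite e pair_count_scale -?e//; have := pair_count_le1 a k (t / a); lra.
Qed.

(** For odd d, the larger of K(d) and K(-d) is at least 1 - a + a(1 - a) = 1 - a^2, so below that
    only even d count. *)
Lemma orbit_count_le_half a k t : 0 < a <= 1 -> t < 1 - a ^+ 2 ->
  orbit_count a k.+2 t <= 1 / 2.
Proof.
move=> a0 ta; rewrite orbit_countS// odd_orbit_countS0; last 2 first.
- by lra.
- by rewrite ltr_pdivrMr; lra.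
by have := orbit_count_le1 a k.+1 (t / a); lra.
Qed.

Lemma bound_count_ge0 a k t : 0 <= bound_count a k t.
Proof. by apply: avg_ge0 => n; case: (code _ _ _ <= _). Qed.

(** For a <= 1/3 one has a <= 1 - 2a, so t < a is covered by exact scaling; for t >= a all even
    words are counted and the right side is already at least 1. *)
Lemma pair_count_le_bound a k t : 0 < a <= 1 / 3 ->
  pair_count a k t <= 2 * bound_count a k t.
Proof.
move=> a0; elim: k t => [|k IH] t.
  by rewrite /pair_count /bound_count /= subrr normr0; case: (0 <= t); rewrite /=; lra.
have [ta|ta] := ltP t a.
  have e : t = a * (t / a) by rewrite mulrC divfK//; lra.
  rewrite {1}e pair_count_scale -?e; [|lra|lra].
  rewrite bound_countS; last by lra.
  by have := IH (t / a); have := bound_count_ge0 a k ((t - 1 + a) / a); lra.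
rewrite bound_countS; last by lra.
rewrite (@bound_count1 _ _ _ (t / a)); last 2 first.
- by lra.
- by rewrite ler_pdivlMr; lra.
have := pair_count_le1 a k.+1 t.
by have := bound_count_ge0 a k ((t - 1 + a) / a); lra.
Qed.

(* For t >= a split off two letters and put t = 1 - a^2 + a^2 v: the left count is
   at most 15/16 + F(v)/8 and the right one at least (1 + F(v))/2, with F(v) the
   [bound_count].  Smaller t follow by scaling. *)
Lemma pair_count_le_orbit a k t : 0 < a <= 1 / 3 -> 0 <= t ->
  8 * pair_count a k t <= 15 * orbit_count a k t.
Proof.
move=> a0; have a0' : 0 < a <= 1 / 2 by lra. have a0'' : 0 < a <= 1 by lra.
have small k' s : s < a -> 8 * pair_count a k' (s / a) <= 15 * orbit_count a k' (s / a) ->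
    8 * pair_count a k'.+1 s <= 15 * orbit_count a k'.+1 s.
  move=> sa; have e : s = a * (s / a) by rewrite mulrC divfK//; lra.
  rewrite {3 4}e pair_count_scale -?e//; last by lra.
  by have := @orbit_count_scale_ge a k' (s / a) a0''; rewrite -e; lra.
have zero s : 0 <= s -> 8 * pair_count a 0 s <= 15 * orbit_count a 0 s.
  by move=> s0; rewrite /pair_count /orbit_count /= subrr normr0 s0 /=; lra.
have step k' s : a <= s -> 8 * pair_count a k'.+2 s <= 15 * orbit_count a k'.+2 s.
  move=> sa; rewrite pair_countS// orbit_countS//.
  rewrite (@orbit_count1 _ _ (s / a)); last 2 first.
  - by lra.
  - by rewrite ler_pdivlMr; lra.
  have := pair_count_le1 a k'.+1 (s / a).
  set u := (s - 1 + a) / a.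
  have := diff_countS_le k' u a0'; have := odd_orbit_countS_ge k' u a0'.
  set v := (u - 1 + a) / a.
  have := diff_count_le_pair a k' v; have := pair_count_le_bound k' v a0.
  by have := bound_count_ge0 a k' v; lra.
(* At rank 1 there is no second letter to split off; the counts left after the first are 0 or 1. *)
have one s : 0 <= s -> 8 * pair_count a 1 s <= 15 * orbit_count a 1 s.
  move=> s0; have [sa|sa] := ltP s a.
    by apply: small => //; apply: zero; apply: divr_ge0; lra.
  rewrite pair_countS// orbit_countS// (@orbit_count1 _ _ (s / a)); last 2 first.
  - by lra.
  - by rewrite ler_pdivlMr; lra.
  have := pair_count_le1 a 0 (s / a).
  rewrite /diff_count /odd_orbit_count /= subrr.
  by case: (0 <= _); rewrite /=; lra.
elim: k t => [|k IH] t t0; first exact: zero.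
have [ta|ta] := ltP t a.
  by apply: small => //; apply: IH; apply: divr_ge0; lra.
by case: k {IH} => [|k]; [exact: one|exact: step].
Qed.

(** At a = 1/2, [code] is bit reversal divided by 2^k: each multiple of 2^-k in [0, 1[ is taken
    once. *)
Lemma bound_count_half k t : 0 <= t <= 1 ->
  t <= bound_count (1 / 2) k t <= t + (2 ^+ k)^-1.
Proof.
have h01 : 0 <= (1 / 2 : R) <= 1 by lra.
elim: k t => [|k IH] t t01.
  rewrite /bound_count /= expr0 invr1; have -> : 0 <= t by lra.
  by rewrite /=; lra.
rewrite bound_countS; last by lra.
have -> : (t - 1 + 1 / 2) / (1 / 2) = 2 * t - 1 by field.
have -> : t / (1 / 2) = 2 * t by field.
rewrite exprS invfM; have [t2|t2] := ltP t (1 / 2).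
  rewrite (@bound_count0 _ _ _ (2 * t - 1)) ?addr0; [|lra|lra].
  by have := IH (2 * t) ltac:(lra); set z := (2 ^+ k)^-1; lra.
rewrite (@bound_count1 _ _ _ (2 * t)) ?addr0; [|lra|lra].
by have := IH (2 * t - 1) ltac:(lra); set z := (2 ^+ k)^-1; lra.
Qed.

(** Only x in ]s, 1 - s] is kept, where the whole window around x lies in [0, 1]. The strips dropped
    cost O(s^2), harmless since the lemma is applied at small s. *)
Lemma pair_count_half k s : (2 ^+ k)^-1 <= 2 * s <= 1 ->
  (2 * s - (2 ^+ k)^-1) * (1 - 2 * s - (2 ^+ k)^-1) <= pair_count (1 / 2) k s.
Proof.
set w := (2 ^+ k)^-1; move=> ws.
have w0 : 0 < w by rewrite invr_gt0 exprn_gt0.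
have /andP[h1 _] := @bound_count_half k (1 - s) ltac:(lra).
have /andP[_ h2] := @bound_count_half k s ltac:(lra); rewrite -/w in h2.
apply: (@le_trans _ _ (avg k (fun m =>
    (2 * s - w) * ((code (1 / 2) k m <= 1 - s)%R%:R - (code (1 / 2) k m <= s)%R%:R)))).
  rewrite avgZ avgB ler_wpM2l; first by [].
    lra.
  rewrite -/(bound_count _ _ _) -/(bound_count _ _ _); lra.
apply: avg_le => m; set x := code _ _ m.
have [x1|x1] := leP x (1 - s); last first.
  have -> : (x <= s) = false by apply/negbTE; rewrite -ltNge; lra.
  by rewrite subrr mulr0; apply: avg_ge0 => n; case: (`|_| <= _).
have [xs|xs] := leP x s.
  by rewrite subrr mulr0; apply: avg_ge0 => n; case: (`|_| <= _).
have /andP[h3 _] := @bound_count_half k (x + s) ltac:(lra).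
have /andP[_ h4] := @bound_count_half k (x - s) ltac:(lra); rewrite -/w in h4.
rewrite subr0 mulr1; apply: (@le_trans _ _ (bound_count (1 / 2) k (x + s)
   - bound_count (1 / 2) k (x - s))); first by lra.
rewrite -avgB; apply: avg_le => n; set y := code _ _ n; rewrite ler_norml.
have [y1|y1] := leP y (x + s); have [y2|y2] := leP y (x - s);
  have [y3|y3] := leP (- s) (x - y); have [y4|y4] := leP (x - y) s; rewrite /=; lra.
Qed.
End Estimates.

(** * The map on cylinders *)

Section Dynamics.
Variable R : realType.
Implicit Types (a x : R) (k : nat) (n : int).

Lemma expr_lt_eps a (e : R) : 0 <= a < 1 -> 0 < e -> exists k, a ^+ k < e.
Proof.
move=> a01 e0; have /cvgrPdist_lt/(_ e e0)[N _ /(_ N (leqnn N))] :=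
  @cvg_expr R a ltac:(rewrite ger0_norm; lra).
rewrite /= sub0r normrN ger0_norm ?exprn_ge0; [|lra|lra].
by exists N.
Qed.

Lemma level_exists a x : 0 < a < 1 / 2 -> 0 <= x < 1 ->
  exists2 j, (0 < j)%N & 1 - a ^+ j.-1 <= x < 1 - a ^+ j.
Proof.
move=> a0 x01; have ex : exists k, a ^+ k < 1 - x by apply: expr_lt_eps; lra.
case: (ex_minnP ex) => -[|j] hj jmin; first by move: hj; rewrite expr0; lra.
exists j.+1 => //=; have [h|h] := ltP (a ^+ j) (1 - x).
  by have := jmin _ h; rewrite ltnn.
by lra.
Qed.

(** The odometer carry: the first letter 0 is in position j, and y is the code of the tail behind
    it. The prefix 1...10 becomes 0...01 and the tail is kept; the word 1...1 becomes 0...0. *)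
Lemma code_succ a k n : 0 <= a <= 1 ->
  (exists j (y : R), [/\ (0 < j <= k)%N, 0 <= y <= 1 - a ^+ (k - j),
     code a k n = 1 - a ^+ j.-1 + a ^+ j * y &
     code a k (n + 1) = a ^+ j.-1 - a ^+ j + a ^+ j * y])
  \/ code a k n = 1 - a ^+ k /\ code a k (n + 1) = 0.
Proof.
move=> a01; elim: k n => [|k IH] n; first by right; rewrite expr0 subrr.
have [q [[] ->]] := int_parity n; last first.
  left; exists 1%N, (code a k q); split => //.
  - by rewrite code_ge0//= subn1 code_le.
  - by rewrite addr0 code_even /= expr1 subrr add0r.
  - by rewrite addr0 code_odd /= expr1.
have -> : q * 2 + true%:Z + 1 = (q + 1) * 2 by rewrite /=; ring.
rewrite code_odd code_even; case: (IH q) => [[j [y [/andP[j0 jk] yr h1 h2]]]|[-> ->]].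
  have ajE : a ^+ j = a * a ^+ j.-1 by rewrite -exprS prednK.
  left; exists j.+1, y; rewrite h1 h2 subSS; split => //=.
  - by rewrite exprS ajE; ring.
  - by rewrite exprS ajE; ring.
by right; rewrite exprS mulr0; split => //; ring.
Qed.

Lemma fmap_code a k n x : 0 < a < 1 / 2 ->
  code a k n <= x <= code a k n + a ^+ k ->
  code a k (n + 1) <= fmap a x <= code a k (n + 1) + a ^+ k.
Proof.
move=> a0; have a01 : 0 <= a <= 1 by lra.
have [[j [y [/andP[j0 jk] yr -> ->]]]|[-> ->]] := code_succ k n a01 => xr.
  rewrite (fmap_left a0 j0); first lra.
  rewrite in_itv /=; have aj : 0 < a ^+ j by apply: exprn_gt0; lra.
  have akj : a ^+ k = a ^+ j * a ^+ (k - j) by rewrite -exprD subnKC.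
  have h1 : a ^+ j * y <= a ^+ j * (1 - a ^+ (k - j)) by rewrite ler_pM2l; lra.
  have h2 : 0 <= a ^+ j * y by rewrite mulr_ge0; lra.
  by rewrite akj in xr; lra.
(* The cylinder of 1...1 reaches up to 1 and meets infinitely many pieces of the map; all must land
   in [0, a^k]. *)
have ak : 0 < a ^+ k by apply: exprn_gt0; lra.
have [->|x1] := eqVneq x 1; first by rewrite fmap1; lra.
have x01 : 0 <= x < 1.
  have : a ^+ k <= 1 by apply: exprn_ile1; lra.
  by move: x1; rewrite neq_lt; lra.
have [j j0 xj] := level_exists a0 x01.
have jk : a ^+ j.-1 <= a ^+ k.
  apply: ler_wiXn2l; [lra|lra|].
  rewrite -ltnS prednK// ltnNge; apply/negP => jk.
  have : a ^+ k <= a ^+ j by apply: ler_wiXn2l; [lra|lra|].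
  by lra.
have aj : 0 < a ^+ j.-1 by apply: exprn_gt0; lra.
have ajE : a ^+ j = a * a ^+ j.-1 by rewrite -exprS prednK.
have ajE2 : a ^+ j.+1 = a * a * a ^+ j.-1 by rewrite -mulrA -ajE -exprS.
have [xl|xl] := leP x (1 - a ^+ j.-1 + a ^+ j).
  rewrite (fmap_left a0 j0); last by rewrite in_itv /=; lra.
  have : a * a ^+ j.-1 <= 1 * a ^+ j.-1 by rewrite ler_pM2r; lra.
  by rewrite ajE; lra.
rewrite (fmap_right a0 j0); last by rewrite in_itv /=; lra.
(* On this gap the map decreases affinely from p to a(1 - a)p, and p <= a^k. *)
set p := a ^+ j.-1 in aj jk xj xl ajE ajE2 *.
have D : 0 < 1 - 2 * a by lra.
have -> : (1 - a + a ^+ 2) / (2 * a - 1) * (x - 1) +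
    a ^+ j.+1 * ((2 - a) / (2 * a - 1)) =
    ((1 - a + a ^+ 2) * (1 - x) - a * a * p * (2 - a)) / (1 - 2 * a).
  by rewrite ajE2; field; lra.
have c0 : 0 < 1 - a + a ^+ 2 by nra.
rewrite ajE in xj xl; rewrite add0r; apply/andP; split.
  apply: divr_ge0; last lra.
  have : (1 - a + a ^+ 2) * (a * p) <= (1 - a + a ^+ 2) * (1 - x).
    by rewrite ler_pM2l; lra.
  have : 0 <= a * p * (1 - a) * (1 - 2 * a) by rewrite !mulr_ge0; lra.
  lra.
rewrite ler_pdivrMr//.
have : (1 - a + a ^+ 2) * (1 - x) <= (1 - a + a ^+ 2) * (p - a * p).
  by rewrite ler_pM2l; lra.
have : p * (1 - 2 * a) <= a ^+ k * (1 - 2 * a) by rewrite ler_pM2r; lra.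
lra.
Qed.

Lemma iter_fmap_code a k n i x : 0 < a < 1 / 2 ->
  code a k n <= x <= code a k n + a ^+ k ->
  code a k (n + i%:Z) <= iter i (fmap a) x <= code a k (n + i%:Z) + a ^+ k.
Proof.
move=> a0 xn; elim: i => [|i IH]; first by rewrite addr0.
by rewrite iterS -[i.+1]addn1 PoszD addrA; exact: fmap_code.
Qed.

(** The map is piecewise affine on the countably many pieces [E i], of level i + 1, and 0 off their
    union. *)
Lemma measurable_fmap a : 0 < a < 1 / 2 -> measurable_fun setT (fmap a).
Proof.
move=> a0; pose E (i : nat) : set R := [set` `[1 - a ^+ i, 1 - a ^+ i.+1[].
have mE (i : nat) : measurable (E i) by exact: measurable_itv.
have mU : measurable (\bigcup_i E i) by exact: bigcupT_measurable.
rewrite -(setvU (\bigcup_i E i)); apply/measurable_funU => //.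
  exact: measurableC.
split.
  apply: (@eq_measurable_fun _ _ _ _ _ (cst (0 : R))); last exact: measurable_cst.
  move=> x; rewrite inE /= => xE; rewrite /fmap; case: ifPn => // x01.
  exfalso; apply: xE; move: x01; rewrite in_itv /= => x01.
  have [[//|j] _ xj] := level_exists a0 x01; exists j => //.
apply/measurable_fun_bigcup => // i.
apply: (@eq_measurable_fun _ _ _ _ _ (fun x : R =>
  if x <= 1 - a ^+ i + a ^+ i.+1 then x - 1 + 2 * a ^+ i - a ^+ i.+1
    else (1 - a + a ^+ 2) / (2 * a - 1) * (x - 1)
         + a ^+ i.+2 * ((2 - a) / (2 * a - 1)))).
  move=> x; rewrite inE => xE; rewrite /fmap (@level_itv _ a i.+1)//.
  by rewrite (@levelE _ a i.+1).
apply: measurable_funTS; apply: measurable_fun_ifT.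
- exact: measurable_fun_ler.
- by apply: measurable_funB => //; apply: measurable_funD => //; apply: measurable_funB.
- apply: measurable_funD => //; apply: measurable_funM => //; exact: measurable_funB.
Qed.

Fixpoint word k n : k.-tuple bool :=
  if k is k'.+1 then [tuple of ((n %% 2)%Z == 1) :: word k' (n %/ 2)%Z]
  else [tuple].

Lemma kappa_cons a k b (u : k.-tuple bool) :
  kappa a [tuple of b :: u] = b%:R * (1 - a) + a * kappa a u.
Proof.
rewrite /kappa big_ord_recl /= expr0 mulr1 tnth0 mulrDr mulrC; congr (_ + _).
rewrite mulrCA; congr (_ * _); rewrite mulr_sumr; apply: eq_bigr => i _.
by rewrite tnthS exprS mulrCA.
Qed.

Lemma kappa_word a k n : kappa a (word k n) = code a k n.
Proof.
elim: k n => [|k IH] n; first by rewrite /kappa big_ord0 mulr0.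
rewrite /= kappa_cons IH; congr (_ * _ + _).
by have [->|->] : (n %% 2)%Z = 0 \/ (n %% 2)%Z = 1 by lia.
Qed.
End Dynamics.

(** * Correlation sums as counting functions *)

Section FinitePartition.
Context d (T : measurableType d) (R : realType) (m : {measure set T -> \bar R}).

Lemma measureI_conull (A U : set T) : measurable A -> measurable U ->
  m (~` U) = 0%E -> m A = m (A `&` U).
Proof.
move=> mA mU m0; rewrite -[in LHS](setUIDK A U) measureU0//.
- exact: measurableI.
- exact: measurableD.
- have mD := measurableD mA mU; have mC := measurableC mU.
  by apply: subset_measure0 m0 => //; rewrite setDE; exact: subIsetr.
Qed.

Lemma measure_finite_bigcup (I : finType) (B : I -> set T) :
  (forall i, measurable (B i)) -> trivIset setT B ->
  m (\bigcup_i B i) = (\sum_i m (B i))%E.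
Proof.
move=> mB tB; rewrite measure_fin_bigcup//; last exact: finite_finset.
rewrite (_ : setT = [set` index_enum I]); last first.
  by apply/seteqP; split => i //= _; exact: mem_index_enum.
by rewrite -fsbig_seq ?index_enum_uniq.
Qed.

Lemma measure_finite_partition (I : finType) (B : I -> set T) (A : set T) :
  (forall i, measurable (B i)) -> trivIset setT B -> measurable A ->
  m (~` \bigcup_i B i) = 0%E -> m A = (\sum_i m (A `&` B i))%E.
Proof.
move=> mB tB mA m0.
have mU : measurable (\bigcup_i B i).
  by apply: fin_bigcup_measurable => //; exact: finite_finset.
rewrite -measure_finite_bigcup; last 2 first.
- by move=> i; exact: measurableI.
- exact: trivIset_setIl.
by rewrite -setI_bigcupr; exact: measureI_conull.
Qed.

(** Since the cells have total mass 1, what they leave out is null; A then lies between the cells it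
    contains and those it meets. *)
Lemma finite_partition_bounds (I : finType) (B : I -> set T) (A : set T) (q : R)
    (P Q : I -> bool) :
  m setT = 1%E -> (forall i, measurable (B i)) -> trivIset setT B ->
  (forall i, m (B i) = q%:E) -> #|I|%:R * q = 1 -> measurable A ->
  (forall i, P i -> B i `<=` A) -> (forall i x, B i x -> A x -> Q i) ->
  \sum_i (P i)%:R * q <= fine (m A) <= \sum_i (Q i)%:R * q.
Proof.
move=> m1 mB tB mBq q1 mA PA AQ.
have mU : measurable (\bigcup_i B i).
  by apply: fin_bigcup_measurable => //; exact: finite_finset.
have q0 : 0 <= q.
  by move: q1; case: (ltP q 0) => // q0; have : 0 <= #|I|%:R :> R by []; nra.
have U1 : m (\bigcup_i B i) = 1%E.
  rewrite measure_finite_bigcup//; under eq_bigr do rewrite mBq.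
  by rewrite sumEFin sumr_const -mulr_natl q1.
have m0 : m (~` \bigcup_i B i) = 0%E.
  have : (m (\bigcup_i B i) + m (~` \bigcup_i B i) = 1)%E.
    rewrite -measureU ?setUv//; first exact: measurableC.
    by rewrite setICr.
  rewrite U1; case: (m _) => //= r [] /eqP; rewrite -subr_eq0 addrAC subrr add0r => /eqP.
  by move=> ->.
have mAE := measure_finite_partition mB tB mA m0.
have le1 i : (m (A `&` B i) <= q%:E)%E.
  rewrite -(mBq i); apply: le_measure; rewrite ?inE//; first exact: measurableI.
have fin i : m (A `&` B i) \is a fin_num.
  by rewrite ge0_fin_numE// (le_lt_trans (le1 i))// ltry.
have le2 i : fine (m (A `&` B i)) <= q by rewrite -lee_fin fineK.
rewrite mAE; have -> : fine (\sum_i m (A `&` B i))%E = \sum_i fine (m (A `&` B i)).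
  by rewrite sum_fine.
apply/andP; split; apply: ler_sum => i _.
  case: (boolP (P i)) => [/PA BA|_]; last by rewrite mul0r fine_ge0.
  by rewrite mul1r setIidr// mBq.
case: (boolP (Q i)) => [_|nQ]; first by rewrite mul1r.
suff -> : A `&` B i = set0 by rewrite measure0 mul0r.
by apply/seteqP; split => x //= [Ax Bx]; move: nQ; rewrite (AQ i x).
Qed.
End FinitePartition.

Section Sandwich.
Variables (R : realType) (a : R) (mu : probability (measurableTypeR R) R).
Hypotheses (a0 : 0 < a < 1 / 2) (hmu : cylinder_uniform a mu).
Implicit Types (k : nat) (m n : int) (l : \bar R) (r : R).

Let a01 : 0 <= a <= 1. Proof. by move: a0; lra. Qed.

Let code_cyl k (i : 'I_(2 ^ k)) : set (measurableTypeR R) := cylinder a (word k i%:Z).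

Let code_cylP k (i : 'I_(2 ^ k)) x :
  code_cyl i x <-> code a k i%:Z <= x <= code a k i%:Z + a ^+ k.
Proof. by rewrite /code_cyl /cylinder kappa_word /= in_itv. Qed.

Let mu_code_cyl k (i : 'I_(2 ^ k)) : mu (code_cyl i) = ((2 ^+ k)^-1)%:E.
Proof.
(* The cylinder condition starts at rank 1; at rank 0 the only cylinder is [0, 1]. *)
case: hmu => mu01 mucyl; case: k i => [|k] i; last exact: mucyl.
by rewrite /code_cyl /cylinder /kappa big_ord0 mulr0 add0r expr0 mu01 expr0 invr1.
Qed.

Let measurable_code_cyl k (i : 'I_(2 ^ k)) : measurable (code_cyl i).
Proof. exact: measurable_itv. Qed.

Let code_cyl_disj k (i j : 'I_(2 ^ k)) x : code_cyl i x -> code_cyl j x -> i = j.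
Proof.
move=> /code_cylP h1 /code_cylP h2; apply: contrapT => /eqP ij.
have : a ^+ k < `|code a k i%:Z - code a k j%:Z|.
  apply: code_sep => //; apply/negP => dv.
  have ij' : (i : nat) <> j by move=> /val_inj; exact/eqP.
  have := ltn_ord i; have := ltn_ord j; move: dv; rewrite /dvdz /= abszX => dv.
  have : (2 ^ k <= `|i%:Z - j%:Z|)%N by apply: dvdn_leq dv; lia.
  by set N := (2 ^ k)%N; lia.
have : `|code a k i%:Z - code a k j%:Z| <= a ^+ k by rewrite ler_norml; lra.
lra.
Qed.

Let code_cyl01 k (i : 'I_(2 ^ k)) x : code_cyl i x -> x \in `[0, 1].
Proof.
move=> /code_cylP; rewrite in_itv /=.
by have := code_ge0 k i%:Z a01; have := code_le k i%:Z a01; lra.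
Qed.

Let close l r : set (R * R) := [set xy : R * R |
    [/\ xy.1 \in `[0, 1], xy.2 \in `[0, 1] & (rho a l xy.1 xy.2 <= r%:E)%E]].

Lemma rho_leP l r x y : (rho a l x y <= r%:E)%E <->
  forall i : nat, (i%:R%:E < l)%E ->
    `|iter i (fmap a) x - iter i (fmap a) y| <= r.
Proof.
split=> [h i il|h]; first by rewrite -lee_fin; apply: le_trans h; apply: ereal_sup_ubound; exists i.
by apply: ge_ereal_sup => _ [i il <-]; rewrite lee_fin; exact: h.
Qed.

Lemma measurable_close l r : measurable (close l r).
Proof.
have mf i : measurable_fun setT (iter i (fmap a)).
  elim: i => [|i IH]; first exact: measurable_id.
  exact: (measurableT_comp (measurable_fmap a0) IH).
have -> : close l r = (`[0, 1]%classic `*` `[0, 1]%classic) `&`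
    \bigcap_i (if (i%:R%:E < l)%E then [set xy : R * R |
      `|iter i (fmap a) xy.1 - iter i (fmap a) xy.2| <= r] else setT).
  apply/seteqP; split => -[x y] /=.
    move=> [x01 y01 /rho_leP h]; split => // i _.
    by case: ifPn => // il; exact: h.
  move=> [[x01 y01] h]; split => //; apply/rho_leP => i il.
  by have := h i Logic.I; rewrite il.
apply: measurableI; first by apply: measurableX; exact: measurable_itv.
apply: bigcapT_measurable => i; case: ifPn => // _.
rewrite -[X in measurable X]setTI.
apply: (@measurable_fun_le _ _ _ setT) => //.
apply: measurableT_comp => //; apply: measurable_funB.
  exact: (measurableT_comp (mf i) measurable_fst).
exact: (measurableT_comp (mf i) measurable_snd).
Qed.

(** Products of rank-k cylinders partition the square up to a null set: P is sufficient for
    closeness on a whole cell, Q necessary at some point of it. *)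
Lemma corr_bounds k l r (P Q : int -> int -> bool) :
  (forall (i j : 'I_(2 ^ k)) x y, code_cyl i x -> code_cyl j y ->
    P i j -> (rho a l x y <= r%:E)%E) ->
  (forall (i j : 'I_(2 ^ k)) x y, code_cyl i x -> code_cyl j y ->
    (rho a l x y <= r%:E)%E -> Q i j) ->
  avg k (fun m => avg k (fun n => (P m n)%:R)) <= corr a mu l r <=
    avg k (fun m => avg k (fun n => (Q m n)%:R)).
Proof.
move=> hP hQ.
have E (S : int -> int -> bool) : avg k (fun m => avg k (fun n => (S m n)%:R)) =
    \sum_(p : 'I_(2 ^ k) * 'I_(2 ^ k)) (S p.1 p.2)%:R * ((2 ^+ k)^-1 * (2 ^+ k)^-1) :> R.
  rewrite -(pair_bigA _ (fun i j : 'I_(2 ^ k) => (S i j)%:R * ((2 ^+ k)^-1 * (2 ^+ k)^-1))) /=.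
  rewrite avgE mulr_sumr; apply: eq_bigr => i _; rewrite avgE mulrA mulr_sumr.
  by apply: eq_bigr => j _; rewrite mulrC.
have boxE (A B : set (measurableTypeR R)) : measurable A -> measurable B ->
    (mu \x mu)%E (A `*` B) = (mu A * mu B)%E.
  exact: product_measure1E.
rewrite !E; apply: (@finite_partition_bounds _ _ _ (mu \x mu)%E _
   (fun p : 'I_(2 ^ k) * 'I_(2 ^ k) => code_cyl p.1 `*` code_cyl p.2) (close l r)
   _ (fun p => P p.1 p.2) (fun p => Q p.1 p.2)).
- by rewrite -setXTT [LHS]boxE// !probability_setT mule1.
- by move=> p; exact: measurableX.
- apply/trivIsetP => -[i1 j1] [i2 j2] _ _ ij; apply/seteqP; split => // -[x y] /=.
  move=> [[h1 h2] [h3 h4]]; move: ij; rewrite (code_cyl_disj h1 h3) (code_cyl_disj h2 h4).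
  by rewrite eqxx.
- by move=> p; rewrite [LHS]boxE// !mu_code_cyl -EFinM.
- have : (2 ^+ k : R) != 0 by rewrite expf_neq0 ?pnatr_eq0.
  by rewrite card_prod card_ord natrM natrX => h; field.
- exact: measurable_close.
- move=> [i j] /= hij [x y] /= [hx hy]; split.
  + exact: code_cyl01 hx.
  + exact: code_cyl01 hy.
  + exact: hP hij.
- by move=> [i j] [x y] /= [hx hy] [_ _ h]; exact: hQ h.
Qed.

Lemma corr1_bounds k r :
  pair_count a k (r - a ^+ k) <= corr a mu 1 r <= pair_count a k (r + a ^+ k).
Proof.
have rho1 x y : (rho a 1 x y <= r%:E)%E <-> `|x - y| <= r.
  split => [/rho_leP/(_ 0%N)|h]; first by apply; rewrite lte_fin.
  by apply/rho_leP => -[|i] //; rewrite lte_fin -[X in _ < X]/(1%:R) ltr_nat.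
apply: corr_bounds => i j x y /code_cylP hx /code_cylP hy.
  by rewrite rho1 !ler_norml => ?; lra.
by rewrite rho1 !ler_norml => ?; lra.
Qed.

Lemma corry_bounds k r :
  orbit_count a k (r - a ^+ k) <= corr a mu +oo r <= orbit_count a k (r + a ^+ k).
Proof.
have E s : orbit_count a k s = avg k (fun m => avg k (fun n =>
    ((code a k (m - n) <= s) && (code a k (n - m) <= s))%R%:R)).
  rewrite -[LHS](avg_diff (f := fun d =>
    ((code a k d <= s) && (code a k (- d) <= s))%R%:R)); last first.
    by move=> n; rewrite code_periodic -[in X in _ && X]code_periodic opprD subrK.
  by apply: eq_avg => m; apply: eq_avg => n; rewrite opprB.
rewrite !E; apply: corr_bounds => i j x y /code_cylP hx /code_cylP hy.
  (* The orbits stay in the cylinders of i + t and j + t, whose codes differ by at most K(i - j) or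
     K(j - i). *)
  move=> /andP[h1 h2]; apply/rho_leP => t _.
  have := iter_fmap_code t a0 hx; have := iter_fmap_code t a0 hy.
  have := codeD k (j%:Z + t%:Z) (i%:Z - j%:Z) a01.
  have := codeD k (i%:Z + t%:Z) (j%:Z - i%:Z) a01.
  have -> : i%:Z + t%:Z + (j%:Z - i%:Z) = j%:Z + t%:Z by ring.
  have -> : j%:Z + t%:Z + (i%:Z - j%:Z) = i%:Z + t%:Z by ring.
  by rewrite ler_norml; lra.
move=> /rho_leP h.
(* At time 2^k - j' the second orbit is in the cylinder of 0, which is [0, a^k], and the first in
   that of i' - j'. *)
have half (i' j' : 'I_(2 ^ k)) x' y' : 
    code a k i'%:Z <= x' <= code a k i'%:Z + a ^+ k ->
    code a k j'%:Z <= y' <= code a k j'%:Z + a ^+ k ->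
    (forall t, iter t (fmap a) x' - iter t (fmap a) y' <= r) ->
    code a k (i'%:Z - j'%:Z) <= r + a ^+ k.
  move=> hx' hy' /(_ (2 ^ k - j')%N).
  have := iter_fmap_code (2 ^ k - j') a0 hx'; have := iter_fmap_code (2 ^ k - j') a0 hy'.
  have e : (2 ^ k - j')%N%:Z = 2 ^+ k - j'%:Z.
    by rewrite -subzn ?(ltnW (ltn_ord _))// -natz natrX.
  rewrite e addrCA subrr addr0 -[X in code a k X]add0r code_periodic code0.
  have -> : i'%:Z + (2 ^+ k - j'%:Z) = i'%:Z - j'%:Z + 2 ^+ k by ring.
  by rewrite code_periodic; lra.
apply/andP; split.
  by apply: half hx hy _ => t; have := h t (ltry _); rewrite ler_norml; lra.
by apply: half hy hx _ => t; have := h t (ltry _); rewrite ler_norml; lra.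
Qed.
End Sandwich.

(** * Existence of the measure *)

Section Existence.
Variable R : realType.
Implicit Types (a w x : R) (k : nat).

(** Its itinerary relative to 1/2 reads off the binary digits of w. *)
Definition doubling w : R := if w < 1 / 2 then 2 * w else 2 * w - 1.

Definition cantor_partial a k w : R :=
  (1 - a) * \sum_(i < k) (1 / 2 <= iter i doubling w)%R%:R * a ^+ i.

(** Reads the binary digits of w as the letters of a point of the Cantor set; the measure is the
    image of the uniform law on [0, 1]. *)
Definition cantor_map a w : R := limn (fun k => cantor_partial a k w).

Lemma cantor_partialS a k w : cantor_partial a k.+1 w =
  (1 / 2 <= w)%R%:R * (1 - a) + a * cantor_partial a k (doubling w).
Proof.
rewrite /cantor_partial big_ord_recl /= expr0 mulr1 mulrDr mulrC; congr (_ + _).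
rewrite mulrCA; congr (_ * _); rewrite mulr_sumr; apply: eq_bigr => i _.
by rewrite /= exprS mulrCA -iterSr.
Qed.

Lemma cantor_partial_range a k w : 0 <= a <= 1 -> 0 <= cantor_partial a k w <= 1.
Proof.
move=> a01; elim: k w => [|k IH] w; first by rewrite /cantor_partial big_ord0 mulr0; lra.
rewrite cantor_partialS; have := IH (doubling w); set y := cantor_partial _ _ _ => h.
by case: (1 / 2 <= w) => /=; nra.
Qed.

Lemma is_cvg_cantor_partial a w : 0 < a < 1 -> cvgn (fun k => cantor_partial a k w).
Proof.
move=> a01; apply: nondecreasing_is_cvgn.
  apply/nondecreasing_seqP => k; rewrite /cantor_partial big_ord_recr /= mulrDr lerDl.
  by apply: mulr_ge0; [lra|apply: mulr_ge0 => //; apply: exprn_ge0; lra].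
exists 1 => _ [k _ <-].
by have := @cantor_partial_range a k w ltac:(lra); lra.
Qed.

Lemma cantor_map_cvg a w : 0 < a < 1 ->
  (fun k => cantor_partial a k w) @ \oo --> cantor_map a w.
Proof. exact: is_cvg_cantor_partial. Qed.

Lemma cantor_mapE a w : 0 < a < 1 ->
  cantor_map a w = (1 / 2 <= w)%R%:R * (1 - a) + a * cantor_map a (doubling w).
Proof.
move=> a01; rewrite {1}/cantor_map; apply/cvg_lim => //.
rewrite -(cvg_shiftS (fun k => cantor_partial a k w)) /=.
rewrite (_ : (fun k => cantor_partial a k.+1 w) = (fun k =>
   (1 / 2 <= w)%R%:R * (1 - a) + a * cantor_partial a k (doubling w))); last first.
  by apply/funext => k; exact: cantor_partialS.
apply: cvgD; first exact: cvg_cst.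
by apply: cvgMr; exact: cantor_map_cvg.
Qed.

Lemma cantor_map_range a w : 0 < a < 1 -> 0 <= cantor_map a w <= 1.
Proof.
move=> a01; apply/andP; split.
  apply: limr_ge; first exact: is_cvg_cantor_partial.
  by apply: nearW => k; have := @cantor_partial_range a k w ltac:(lra); lra.
apply: limr_le; first exact: is_cvg_cantor_partial.
by apply: nearW => k; have := @cantor_partial_range a k w ltac:(lra); lra.
Qed.

Lemma measurable_doubling : measurable_fun setT doubling.
Proof.
apply: measurable_fun_ifT; first exact: measurable_fun_ltr.
  exact: measurable_funM.
by apply: measurable_funB => //; exact: measurable_funM.
Qed.

Lemma measurable_cantor_partial a k : measurable_fun setT (cantor_partial a k).
Proof.
elim: k => [|k IH].
  by rewrite (_ : cantor_partial a 0 = cst 0)//; apply/funext => w;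
     rewrite /cantor_partial big_ord0 mulr0.
rewrite (_ : cantor_partial a k.+1 = fun w =>
  (if w < 1 / 2 then 0 else 1 - a) + a * cantor_partial a k (doubling w)); last first.
  apply/funext => w; rewrite cantor_partialS leNgt; case: ifP => _ /=.
    by rewrite mul0r.
  by rewrite mul1r.
apply: measurable_funD.
  by apply: measurable_fun_ifT => //; exact: measurable_fun_ltr.
apply: measurable_funM => //.
exact: (measurableT_comp IH measurable_doubling).
Qed.

Lemma measurable_cantor_map a : 0 < a < 1 -> measurable_fun setT (cantor_map a).
Proof.
move=> a01; apply: (measurable_fun_cvg (measurable_cantor_partial a)) => w _.
exact: cantor_map_cvg.
Qed.

Lemma kappa_range a k (u : k.-tuple bool) : 0 <= a <= 1 ->
  0 <= kappa a u <= 1 - a ^+ k.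
Proof.
move=> a01; elim: k u => [|k IH] u; first by rewrite /kappa big_ord0 mulr0 expr0; lra.
case/tupleP: u => b u; rewrite kappa_cons exprS; have := IH u.
by set y := kappa a u => h; case: b => /=; nra.
Qed.

(** The preimage is a dyadic interval whose left end p has the letters of u as binary digits, hence
    (b + p) / 2 when a letter b is put in front. *)
Lemma cantor_map_preimage a k (u : k.-tuple bool) : 0 < a < 1 / 2 ->
  exists p : R, [/\ 0 <= p, p + (2 ^+ k)^-1 <= 1 &
    forall w, 0 <= w < 1 -> (cylinder a u (cantor_map a w) <-> p <= w < p + (2 ^+ k)^-1)].
Proof.
move=> a0; have a01 : 0 < a < 1 by lra.
elim: k u => [|k IH] u.
  exists 0; rewrite expr0 invr1; split; [by []|lra|] => w w01.
  rewrite /cylinder /kappa big_ord0 /= in_itv /= mulr0 expr0.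
  by have := cantor_map_range w a01; split => // _; lra.
case/tupleP: u => b u; have [p [p0 p1 hp]] := IH u.
have e : (2 ^+ k.+1)^-1 = (2 ^+ k)^-1 / 2 :> R by rewrite exprSr invfM.
have w0 : 0 < (2 ^+ k)^-1 :> R by rewrite invr_gt0 exprn_gt0.
set q := (2 ^+ k)^-1 in e w0 p1 hp *; rewrite e.
exists ((b%:R + p) / 2); split; [case: b => /=; lra|case: b => /=; lra|] => w w01.
have d01 : 0 <= doubling w < 1 by rewrite /doubling; case: ltP; lra.
have hd := hp _ d01; rewrite {1}/cylinder /= in_itv /= in hd.
rewrite {1}/cylinder /= in_itv /= kappa_cons cantor_mapE// exprS.
have := cantor_map_range (doubling w) a01; have := @kappa_range a k u ltac:(lra).
set y := cantor_map a _ in hd *; set s := kappa a u in hd * => sr yr.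
have ak0 : 0 <= a ^+ k by apply: exprn_ge0; lra.
have sa : 0 <= a * s by apply: mulr_ge0; lra.
have sa1 : a * (s + a ^+ k) <= a * 1 by rewrite ler_pM2l; lra.
have ya0 : 0 <= a * y by apply: mulr_ge0; lra.
have ya1 : a * y <= a * 1 by rewrite ler_pM2l; lra.
have hd' : (a * s <= a * y <= a * s + a * a ^+ k) <-> p <= doubling w < p + q.
  by rewrite -mulrDr !ler_pM2l; [exact: hd|lra..].
rewrite mulrDl mulr1 in ya1 sa1 *.
(* If b is not the first digit of w, both sides fail, on the left because a < 1/2 separates the two
   halves. *)
move: hd'; rewrite /doubling; have [w2|w2] := ltP w (1 / 2); case: b => /= hd'.
- by split => h; lra.
- by split => h; [have /hd' : a * s <= a * y <= a * s + a * a ^+ k by lra|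
                  have /hd' : p <= 2 * w < p + q by lra]; lra.
- by split => h; [have /hd' : a * s <= a * y <= a * s + a * a ^+ k by lra|
                  have /hd' : p <= 2 * w - 1 < p + q by lra]; lra.
- by split => h; lra.
Qed.

Lemma uniform_prob_itv (p q : R) : 0 <= p -> p <= q -> q <= 1 ->
  uniform_prob (@ltr01 R) [set` `[p, q[] = (q - p)%:E.
Proof.
move=> p0 pq q1; rewrite /uniform_prob.
rewrite (eq_integral (fun=> 1%:E)); last first.
  move=> x; rewrite inE /= in_itv /= => xpq.
  by rewrite /uniform_pdf subr0 invr1 (_ : 0 <= x <= 1 = true)//; lra.
rewrite integral_cst//= mul1e lebesgue_measure_itv /= lte_fin.
by move: pq; rewrite le_eqVlt => /orP[/eqP ->|->]; rewrite ?ltxx ?subrr// EFinB.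
Qed.

Lemma cylinder_uniform_exists a : 0 < a < 1 / 2 ->
  exists mu : probability (measurableTypeR R) R, cylinder_uniform a mu.
Proof.
move=> a0; have a01 : 0 < a < 1 by lra.
pose X : {mfun measurableTypeR R >-> measurableTypeR R} :=
  HB.pack (cantor_map a) 
    (isMeasurableFun.Build _ _ (measurableTypeR R) (measurableTypeR R) (cantor_map a)
      (measurable_cantor_map a01)).
have mX (A : set R) : measurable A -> measurable (cantor_map a @^-1` A).
  by move=> mA; rewrite -[X in measurable X]setTI; exact: measurable_cantor_map.
pose P : probability (measurableTypeR R) R := uniform_prob (@ltr01 R).
have PE (p q : R) : 0 <= p -> p <= q -> q <= 1 -> P [set` `[p, q[] = (q - p)%:E.
  exact: uniform_prob_itv.
have C1 : P [set` `[(0 : R), 1[] = 1%E by rewrite PE// subr0.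
have C0 : P (~` [set` `[(0 : R), 1[]) = 0%E.
  by rewrite probability_setC// C1 subee.
have onC (A : set R) : measurable A -> P A = P (A `&` [set` `[(0 : R), 1[]).
  by move=> mA; exact: measureI_conull.
exists (distribution P X); split.
  rewrite /distribution /pushforward /= (_ : _ @^-1` _ = setT) ?probability_setT//.
  by apply/seteqP; split => // w _ /=; rewrite in_itv /= cantor_map_range.
move=> k u _; have [p [p0 p1 hp]] := cantor_map_preimage u a0.
have q0 : 0 < (2 ^+ k)^-1 :> R by rewrite invr_gt0 exprn_gt0.
transitivity (P (cantor_map a @^-1` cylinder a u)); first by [].
rewrite onC; last by apply: mX; exact: measurable_itv.
have -> : cantor_map a @^-1` cylinder a u `&` [set` `[(0 : R), 1[] = [set` `[p, p + (2 ^+ k)^-1[].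
  apply/seteqP; split => w /=; rewrite !in_itv /=.
    by move=> [h1 h2]; have := (hp w h2).1 h1.
  move=> h; have w01 : 0 <= w < 1 by lra.
  by split => //; exact: (hp w w01).2.
by rewrite PE//; [congr EFin; ring|lra].
Qed.
End Existence.

(** * Limits of the counting functions *)

Section CorrLimits.
Variable R : realType.
Implicit Types (a b r x y : R) (k : nat).

(** Removes the error of rank k. The variants with k + 1 and k + 2 serve recursions that start only
    at those ranks. *)
Lemma le_dyadic (C x y : R) : (forall k, x <= y + C / 2 ^+ k) -> x <= y.
Proof.
move=> h; apply/ler_addgt0Pr => e e0.
have [C0|C0] := leP C 0.
  by have := h 0%N; rewrite expr0 divr1; lra.
have [k hk] := @expr_lt_eps R (1 / 2) (e / C) ltac:(lra) ltac:(by apply: divr_gt0).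
apply: (le_trans (h k)); rewrite lerD2l ltW//.
by move: hk; rewrite ltr_pdivlMr// expr_div_n expr1n mulrC mul1r.
Qed.

Lemma le_dyadicS (C x y : R) : (forall k, x <= y + C / 2 ^+ k.+1) -> x <= y.
Proof.
move=> h; apply: (@le_dyadic (C / 2)) => k; apply: le_trans (h k) _.
by rewrite exprS invfM mulrA.
Qed.

Lemma le_dyadicSS (C x y : R) : (forall k, x <= y + C / 2 ^+ k.+2) -> x <= y.
Proof.
move=> h; apply: (@le_dyadicS (C / 2)) => k; apply: le_trans (h k) _.
by rewrite exprS invfM mulrA.
Qed.

(** * Transfer from counts to correlation sums *)

Section OneParameter.
Variables (a : R) (mu : probability (measurableTypeR R) R).
Hypotheses (a0 : 0 < a < 1 / 2) (hmu : cylinder_uniform a mu).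
Local Notation c1 := (corr a mu 1%E).
Local Notation cy := (corr a mu +oo%E).

Lemma corr1_approx k r : c1 r - 2 / 2 ^+ k <= pair_count a k r <= c1 r + 2 / 2 ^+ k.
Proof.
have a2 : 0 < a <= 1 / 2 by move: a0; lra.
have := corr1_bounds a0 hmu k r; have := pair_count_step k r a2.
by have := pair_count_step k (r - a ^+ k) a2; rewrite subrK; lra.
Qed.

Lemma corry_approx k r : cy r - 2 / 2 ^+ k <= orbit_count a k r <= cy r + 2 / 2 ^+ k.
Proof.
have a2 : 0 < a <= 1 / 2 by move: a0; lra.
have := corry_bounds a0 hmu k r; have := orbit_count_step k r a2.
by have := orbit_count_step k (r - a ^+ k) a2; rewrite subrK; lra.
Qed.

Lemma corr1_scale_ge r : c1 r / 2 <= c1 (a * r).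
Proof.
apply: (@le_dyadicS 4) => k.
have := @pair_count_scale_ge _ a k r ltac:(by move: a0; lra).
have := corr1_approx k r; have := corr1_approx k.+1 (a * r).
rewrite exprS invfM; move: (2 ^+ k)^-1 (c1 r) (c1 (a * r)) => w x y.
by move: (pair_count _ _ _) (pair_count _ _ _) => p q; lra.
Qed.

Lemma corr1_scale r : a * r < 1 - 2 * a -> c1 (a * r) = c1 r / 2.
Proof.
move=> ar; apply/le_anti; rewrite corr1_scale_ge andbT.
apply: (@le_dyadicS 4) => k.
have := @pair_count_scale _ a k r ltac:(by move: a0; lra) ar.
have := corr1_approx k r; have := corr1_approx k.+1 (a * r).
rewrite exprS invfM; move: (2 ^+ k)^-1 (c1 r) (c1 (a * r)) => w x y.
by move: (pair_count _ _ _) (pair_count _ _ _) => p q; lra.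
Qed.

Lemma corry_scale r : a * r < 1 - a -> cy (a * r) = cy r / 2.
Proof.
move=> ar.
have h k := @orbit_count_scale _ a k r ltac:(by move: a0; lra) ar.
apply/le_anti/andP; split; apply: (@le_dyadicS 4) => k; have {h} := h k;
  have := corry_approx k r; have := corry_approx k.+1 (a * r);
  rewrite exprS invfM; move: (2 ^+ k)^-1 (cy r) (cy (a * r)) => w x y;
  by move: (orbit_count _ _ _) (orbit_count _ _ _) => p q; lra.
Qed.

Lemma corry_ge_half r : a <= r -> 1 / 2 <= cy r.
Proof.
move=> ar; apply: (@le_dyadicS 2) => k.
have := @orbit_count_ge_half _ a k r ltac:(by move: a0; lra) ar.
by have := corry_approx k.+1 r; lra.
Qed.

Lemma corr1_le_half r : r < 1 - 2 * a -> c1 r <= 1 / 2.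
Proof.
move=> ar; apply: (@le_dyadicS 2) => k.
have := @pair_count_le_half _ a k r ltac:(by move: a0; lra) ar.
by have := corr1_approx k.+1 r; lra.
Qed.

Lemma corry_le_half r : r < 1 - a ^+ 2 -> cy r <= 1 / 2.
Proof.
move=> ar; apply: (@le_dyadicSS 2) => k.
have := @orbit_count_le_half _ a k r ltac:(by move: a0; lra) ar.
by have := corry_approx k.+2 r; lra.
Qed.

Lemma corr1_le_corry r : a <= 1 / 3 -> 0 <= r -> 8 * c1 r <= 15 * cy r.
Proof.
move=> a3 r0; apply: (@le_dyadic 46) => k.
have := @pair_count_le_orbit _ a k r ltac:(by move: a0; lra) r0.
have := corry_approx k r; have := corr1_approx k r.
move: (2 ^+ k)^-1 (cy r) (c1 r) => w x y.
by move: (orbit_count _ _ _) (pair_count _ _ _) => p q; lra.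
Qed.

Lemma corry_le_corr1 r : cy r <= c1 r.
Proof.
apply: (@le_dyadic 4) => k.
have := @orbit_le_pair _ a k r ltac:(by move: a0; lra).
have := corry_approx k r; have := corr1_approx k r.
move: (2 ^+ k)^-1 (cy r) (c1 r) => w x y.
by move: (orbit_count _ _ _) (pair_count _ _ _) => p q; lra.
Qed.

Lemma corry_ge k r : a ^+ k <= r -> (2 ^+ k)^-1 <= cy r.
Proof.
move=> ar; have := corry_bounds a0 hmu k r.
by have := @orbit_count_ge _ a k (r - a ^+ k) ltac:(by lra); lra.
Qed.

Lemma corry_gt0 r : 0 < r -> 0 < cy r.
Proof.
move=> r0; have [k hk] := @expr_lt_eps R a r ltac:(by move: a0; lra) r0.
apply: lt_le_trans (corry_ge (ltW hk)).
by rewrite invr_gt0 exprn_gt0.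
Qed.

Lemma corr1_scale_iter_ge k r : c1 r / 2 ^+ k <= c1 (a ^+ k * r).
Proof.
elim: k => [|k IH]; first by rewrite !expr0 mul1r divr1.
have := corr1_scale_ge (a ^+ k * r).
rewrite mulrA -exprS [2 ^+ _]exprS invfM; move: IH.
by move: (2 ^+ k)^-1 (c1 r) (c1 _) (c1 _) => w x y z; lra.
Qed.

(** For r <= 1 one has a r <= a < 1 - a, so each step scales exactly, however close a is to 1/2. *)
Lemma corry_scale_iter k r : 0 <= r <= 1 -> cy (a ^+ k * r) = cy r / 2 ^+ k.
Proof.
move=> r01; elim: k => [|k IH]; first by rewrite !expr0 mul1r divr1.
have ak : a ^+ k * r <= 1.
  clear IH; have : 0 <= a ^+ k <= 1 by rewrite exprn_ge0 ?exprn_ile1//; move: a0; lra.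
  by nra.
rewrite exprS -mulrA corry_scale ?IH; first by rewrite exprS invfM; ring.
have {IH} : a * (a ^+ k * r) <= a * 1 by rewrite ler_pM2l; clear IH; move: a0; lra.
by move: a0; lra.
Qed.

Lemma det_infty_scale r : a * r < 1 - 2 * a -> det_infty a mu (a * r) = det_infty a mu r.
Proof.
move=> ar; rewrite /det_infty corr1_scale// corry_scale; last by move: a0; lra.
move: (cy r) (c1 r) => y x; rewrite invfM invrK mulrACA mulVf ?mulr1//.
Qed.

Lemma det_infty_range r : 0 < r -> 0 <= det_infty a mu r <= 1.
Proof.
move=> r0; have y0 := corry_gt0 r0; have := corry_le_corr1 r => y1.
rewrite /det_infty; move: y0 y1; move: (cy r) (c1 r) => y x y0 y1.
by apply/andP; split; [apply: divr_ge0|rewrite ler_pdivrMr]; lra.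
Qed.
End OneParameter.

(** Parameters at least 1/4 make the shift 4|a - b| at most b^k, one window step. This costs 2 /
    2^k, and each of the two approximations at rank k costs as much. *)
Lemma corr_near a b mu nu k r : 1 / 4 <= a < 1 / 2 -> 1 / 4 <= b < 1 / 2 ->
  cylinder_uniform a mu -> cylinder_uniform b nu ->
  4 * `|a - b| <= (1 / 4) ^+ k ->
  corr a mu 1 r <= corr b nu 1 r + 6 / 2 ^+ k /\
  corr a mu +oo r <= corr b nu +oo r + 6 / 2 ^+ k.
Proof.
move=> a1 b1 hmu hnu ab.
have a0 : 0 < a < 1 / 2 by lra. have b0 : 0 < b < 1 / 2 by lra.
have bk : (1 / 4) ^+ k <= b ^+ k by apply: lerXn2r; rewrite ?nnegrE; lra.
have le : r + 4 * `|a - b| <= r + b ^+ k by lra.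
split.
  have := @pair_count_lip _ a b k r ltac:(lra) ltac:(lra).
  have := le_pair_count b k le; have := @pair_count_step _ b k r ltac:(lra).
  have := corr1_approx a0 hmu k r; have := corr1_approx b0 hnu k r; clear.
  move: (corr a mu 1%E r) (corr b nu 1%E r) (2 ^+ k)^-1 => x y w.
  move: (pair_count a k r) (pair_count b k r) => p q.
  by move: (pair_count _ _ _) (pair_count _ _ _) => p' q'; lra.
have := @orbit_count_lip _ a b k r ltac:(lra) ltac:(lra).
have := le_orbit_count b k le; have := @orbit_count_step _ b k r ltac:(lra).
have := corry_approx a0 hmu k r; have := corry_approx b0 hnu k r; clear.
move: (corr a mu +oo%E r) (corr b nu +oo%E r) (2 ^+ k)^-1 => x y w.
move: (orbit_count a k r) (orbit_count b k r) => p q.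
by move: (orbit_count _ _ _) (orbit_count _ _ _) => p' q'; lra.
Qed.

Lemma bernoulli_le (t : R) k : 0 <= t <= 1 -> 1 - k%:R * t <= (1 - t) ^+ k.
Proof.
move=> t01; elim: k => [|k IH]; first by rewrite mul0r expr0 subr0.
rewrite exprS -natr1.
have : (1 - t) * (1 - k%:R * t) <= (1 - t) * (1 - t) ^+ k by apply: ler_wpM2l; lra.
have : 0 <= t * (k%:R * t) by rewrite !mulr_ge0//; lra.
lra.
Qed.

(* So close to 1/2 that, at rank 2n, the words cannot tell it from 1/2. *)
Definition half_minus n : R := 1 / 2 - (4 ^+ (2 * n).+1)^-1.

Lemma expV2n_range n : (1 < n)%N -> 0 < (2 ^- n : R) <= 1 / 4.
Proof.
move=> n1; rewrite invr_gt0 exprn_gt0//= -(subnK n1) exprD invfM.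
have : (2 ^+ (n - 2))^-1 <= 1 :> R by rewrite invf_le1 ?exprn_gt0// exprn_ege1//; lra.
by rewrite (_ : (2 ^+ 2)^-1 = 1 / 4); [set y := (2 ^+ _)^-1; lra|field].
Qed.

Lemma half_minusE n : half_minus n = 1 / 2 - (2 ^- n) ^+ 4 / 4.
Proof.
have q4 : (4 ^+ (2 * n))^-1 = (2 ^- n) ^+ 4 :> R.
  have -> : (4 : R) = 2 ^+ 2 by ring.
  by rewrite exprVn -!exprM; congr ((_ ^+ _)^-1); lia.
by rewrite /half_minus exprS invfM q4 [4^-1 * _]mulrC.
Qed.

Lemma half_minus_range n : (1 < n)%N -> 1 / 4 <= half_minus n < 1 / 2.
Proof.
move=> /expV2n_range; rewrite half_minusE; set x : R := 2 ^- n => xr.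
have : 0 < x ^+ 4 <= 1 / 16.
  rewrite exprn_gt0/=; last lra.
  apply: (@le_trans _ _ ((1 / 4) ^+ 4)); last by rewrite !exprS expr0; lra.
  by apply: lerXn2r => //; rewrite ?nnegrE; lra.
by lra.
Qed.

(** With x = 2^-n, the sum c_1 at scale b^n r is of order x. Rank k = 2n makes the errors O(2^-k) =
    O(x^2), hence negligible. *)
Lemma corr_half_minus n mu r : (1 < n)%N -> cylinder_uniform (half_minus n) mu ->
  1 / 4 <= r <= 1 ->
  corr (half_minus n) mu +oo r <= r + 4 * (2 ^- n) ^+ 2 /\
  (2 * r - 13 * 2 ^- n) / 2 ^+ n <= corr (half_minus n) mu 1 (half_minus n ^+ n * r).
Proof.
move=> n1; have := expV2n_range n1; have := half_minus_range n1.
have := half_minusE n; set b := half_minus n; set x : R := 2 ^- n => bE b1 xr hmu r1.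
have x0 : 0 < x by lra. have x4 : x <= 1 / 4 by lra.
have b0 : 0 < b < 1 / 2 by lra.
set k := (2 * n)%N; set w : R := (2 ^+ k)^-1.
have wE : w = x ^+ 2 by rewrite /w /x /k -exprVn mulnC exprM exprVn.
have q4' : (1 / 4) ^+ k = x ^+ 4.
  have -> : 1 / 4 = 2 ^- 2 :> R by field.
  by rewrite /x !exprVn -!exprM; congr ((_ ^+ _)^-1); rewrite /k; lia.
have x4' : 0 < x ^+ 4 <= 1 by rewrite exprn_gt0//= exprn_ile1//; lra.
have x40 : 0 < x ^+ 4 by apply: exprn_gt0.
have bk : (1 / 4) ^+ k <= b ^+ k by apply: lerXn2r; rewrite ?nnegrE; lra.
have hk : (1 / 4) ^+ k <= (1 / 2) ^+ k :> R by apply: lerXn2r; rewrite ?nnegrE; lra.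
have bh : 4 * `|b - 1 / 2| = x ^+ 4.
  by rewrite bE addrAC subrr sub0r normrN ger0_norm; lra.
have hb : 4 * `|1 / 2 - b| = x ^+ 4 by rewrite distrC.
split.
  have := corry_approx b0 hmu k r; rewrite -/w.
  have := orbit_le_bound b k r.
  have := @bound_count_lip _ b (1 / 2) k r ltac:(lra) ltac:(lra); rewrite bh.
  have := @bound_count_step _ (1 / 2) k r ltac:(lra).
  have := @le_bound_count _ (1 / 2) k (r + x ^+ 4) (r + (1 / 2) ^+ k) ltac:(by lra).
  have := @bound_count_half _ k r ltac:(lra); rewrite -/w -wE; clear.
  move: (corr _ _ _ _) (bound_count b k r) (orbit_count b k r) => c p q.
  move: (bound_count (1 / 2) k r) (bound_count _ _ _) (bound_count _ _ _) => p1 p2 p3.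
  by lra.
set s := b ^+ n * r.
(* 2b = 1 - x^4 / 2, so Bernoulli and n x <= 1 show that b^n is close to 2^-n. *)
have bn : 1 - x <= 2 ^+ n * b ^+ n <= 1.
  rewrite -exprMn (_ : 2 * b = 1 - x ^+ 4 / 2); last by rewrite bE; field.
  rewrite exprn_ile1 ?andbT; [|lra|lra].
  have := @bernoulli_le (x ^+ 4 / 2) n ltac:(lra).
  have nx : n%:R * x <= 1.
    by rewrite /x ler_pdivrMr ?exprn_gt0// mul1r -natrX ler_nat ltnW// ltn_expl.
  have : n%:R * (x ^+ 4 / 2) <= x.
    have -> : n%:R * (x ^+ 4 / 2) = (n%:R * x) * (x * x * (x / 2)) by rewrite !exprS expr0; field.
    have xx : 0 <= x * x <= x by apply/andP; split; nra.
    have z : 0 <= x * x * (x / 2) <= x by move: xx; set y := x * x => xx; apply/andP; split; nra.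
    by apply: le_trans (_ : 1 * (x * x * (x / 2)) <= _); [apply: ler_wpM2r => //; lra|lra].
  by move: (n%:R * _) (_ ^+ n) => y z; lra.
have xn : x * 2 ^+ n = 1 by rewrite /x mulVf// expf_neq0 ?pnatr_eq0.
have sx : s = x * (2 ^+ n * b ^+ n) * r by rewrite mulrA xn mul1r.
set t := 2 ^+ n * b ^+ n in bn sx; set p := t * r.
have sE : s = x * p by rewrite /p mulrA -sx.
have p1 : r - x <= p <= r by rewrite /p; apply/andP; split; nra.
have p2 : 3 / 16 <= p by rewrite /p; nra.
have s1 : x ^+ 2 <= 2 * s <= 1.
  have : x * x <= x * (2 * p) by rewrite ler_pM2l; lra.
  have : x * p <= x * 1 by rewrite ler_pM2l; lra.
  by rewrite expr2 sE; lra.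
have := corr1_approx b0 hmu k s; rewrite -/w wE.
have := @pair_count_half _ k s; rewrite -/w wE => /(_ s1).
have := @pair_count_lip _ (1 / 2) b k s ltac:(lra) ltac:(lra); rewrite hb.
have := @pair_count_step _ b k s ltac:(lra); rewrite -/w wE.
have := @le_pair_count _ b k (s + x ^+ 4) (s + b ^+ k) ltac:(by lra).
(* The term 4 x^2 is one approximation and one window step at rank k. With p >= r - x and r <= 1,
   the 13 is 3 + 6 + 4. *)
suff : (2 * r - 13 * x) * x <= (2 * s - x ^+ 2) * (1 - 2 * s - x ^+ 2) - 4 * x ^+ 2.
  rewrite -/x; clear; set L := (_ - _) * (1 - _ - _).
  move: (corr _ _ _ _) (pair_count b k s) => c q.
  by move: (pair_count _ _ _) (pair_count _ _ _) (pair_count _ _ _) => p1 p2 p3; lra.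
rewrite sE.
have -> : (2 * (x * p) - x ^+ 2) * (1 - 2 * (x * p) - x ^+ 2) - 4 * x ^+ 2
  = ((2 * p - x) * (1 - 2 * (x * p) - x ^+ 2) - 4 * x) * x by ring.
rewrite ler_pM2r//.
have xp : x * p <= x * 1 by rewrite ler_pM2l; lra.
have xx : x ^+ 2 <= x * 1 by rewrite expr2 ler_pM2l; lra.
have : (2 * p - x) * (1 - 3 * x) <= (2 * p - x) * (1 - 2 * (x * p) - x ^+ 2).
  by apply: ler_wpM2l; lra.
have := sqr_ge0 x; lra.
Qed.
End CorrLimits.

(** * Scale-invariant families *)

Section ScaleInvariant.
Variable R : realType.
Implicit Types (a b r : R) (g : R -> R).

(** [a r0, r0] is a fundamental domain for r -> a r. *)
Lemma scale_up a (r0 r : R) : 0 < a < 1 -> 0 < r <= r0 ->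
  exists n s, a * r0 <= s <= r0 /\ r = a ^+ n * s.
Proof.
move=> a01 r01; have ex : exists k, a ^+ k < r / r0.
  by apply: expr_lt_eps; [lra|apply: divr_gt0; lra].
case: (ex_minnP ex) => -[|n] hn nmin.
  by move: hn; rewrite expr0 ltr_pdivlMr; lra.
have an : 0 < a ^+ n by apply: exprn_gt0; lra.
exists n, (r / a ^+ n); split; last by rewrite mulrC divfK// gt_eqF.
rewrite ler_pdivlMr// ler_pdivrMr//; apply/andP; split.
  by move: hn; rewrite ltr_pdivlMr ?exprS; lra.
rewrite mulrC; have [h|h] := ltP (a ^+ n) (r / r0).
  by have := nmin _ h; rewrite ltnn.
by move: h; rewrite ler_pdivrMr; lra.
Qed.

Lemma scale_invariant_iter a (r0 : R) g n r : 0 < a < 1 ->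
  (forall s, 0 < s <= r0 -> g (a * s) = g s) -> 0 < r <= r0 ->
  0 < a ^+ n * r <= r0 /\ g (a ^+ n * r) = g r.
Proof.
move=> a01 gP r01; elim: n => [|n [IH1 IH2]]; first by rewrite expr0 mul1r.
rewrite exprS -mulrA gP//; split => //.
have : 0 < a * (a ^+ n * r) by apply: mulr_gt0; lra.
by set y := a ^+ n * r in IH1 *; nra.
Qed.

Lemma limf_esup_scale_invariant a (r0 S : R) g : 0 < a < 1 -> 0 < r0 ->
  (forall r, 0 < r <= r0 -> g (a * r) = g r) ->
  (forall r, 0 < r <= r0 -> g r <= S) ->
  (forall e, 0 < e -> exists2 r, 0 < r <= r0 & S - e < g r) ->
  limf_esup (fun r => (g r)%:E) 0^'+ = S%:E.
Proof.
move=> a01 r00 gP gS gS'; rewrite limf_esupE; apply/le_anti/andP; split.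
  apply: ge_ereal_inf; exists (ereal_sup [set (g r)%:E | r in [set r | 0 < r <= r0]]).
    exists [set r | 0 < r <= r0] => //.
    near=> r => /=; apply/andP; split; near: r; first exact: nbhs_right_gt.
    exact: nbhs_right_le.
  by apply: ge_ereal_sup => _ [r hr <-]; rewrite lee_fin; exact: gS.
apply: le_ereal_inf_tmp => _ [V V0 <-].
apply/lee_addgt0Pr => e e0.
have [r r01 hr] := gS' _ e0.
have [d d0 hd] : exists2 d : R, 0 < d & forall t, 0 < t < d -> V t.
  move: V0 => /=; rewrite /at_right /within /= => /nbhs_ballP[d /= d0 hd].
  exists d => // t td; apply: hd; last by move: td => /andP[].
  by rewrite /ball /= sub0r normrN gtr0_norm; lra.
(* Multiplying r by a^n brings it into V without changing g. *)
have [n hn] := @expr_lt_eps R a (d / r0) ltac:(lra) ltac:(apply: divr_gt0; lra).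
have [h1 h2] := scale_invariant_iter n a01 gP r01.
apply: (@le_trans _ _ ((g r)%:E + e%:E)%E); first by rewrite -EFinD lee_fin; lra.
rewrite leeD2r//; apply: ereal_sup_ubound; exists (a ^+ n * r); last by rewrite h2.
apply: hd; apply/andP; split; first lra.
move: hn; rewrite ltr_pdivlMr// => hn; apply: le_lt_trans hn.
by rewrite ler_wpM2l ?exprn_ge0; lra.
Unshelve. all: by end_near.
Qed.

(** The supremum over ]0, r0] is one over [a r0, r0], inside [lo r0, r0] and so away from 0. There
    closeness in a is uniform in r, which makes the supremum continuous in a without any continuity
    in r. *)
Lemma scale_invariant_family_ivt (lo hi r0 v : R) (g : R -> R -> R) :
  0 < lo -> lo <= hi -> hi < 1 -> 0 < r0 ->
  (forall a r, lo <= a <= hi -> 0 < r <= r0 -> g a (a * r) = g a r) ->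
  (forall a r, lo <= a <= hi -> 0 < r <= r0 -> `|g a r| <= 1) ->
  (forall e, 0 < e -> exists2 d, 0 < d & forall a b r, lo <= a <= hi -> lo <= b <= hi ->
     `|a - b| < d -> lo * r0 <= r <= r0 -> g a r <= g b r + e) ->
  (exists2 r, 0 < r <= r0 & v <= g lo r) /\ (forall r, 0 < r <= r0 -> g hi r <= v) \/
  (forall r, 0 < r <= r0 -> g lo r <= v) /\ (exists2 r, 0 < r <= r0 & v <= g hi r) ->
  exists2 a, lo <= a <= hi & limf_esup (fun r => (g a r)%:E) 0^'+ = v%:E.
Proof.
move=> lo0 lohi hi1 r00 gP gB gC gE.
pose W a : set R := [set g a r | r in [set r | 0 < r <= r0]].
pose S a := sup (W a).
have supW a : lo <= a <= hi -> has_sup (W a).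
  move=> al; split; first by exists (g a r0), r0 => //=; lra.
  exists 1 => _ [r hr <-]; have := gB _ _ al hr; rewrite ler_norml; lra.
have S_ge a r : lo <= a <= hi -> 0 < r <= r0 -> g a r <= S a.
  by move=> al hr; apply: sup_upper_bound; [exact: supW|exists r].
have S_le a y : lo <= a <= hi -> (forall r, 0 < r <= r0 -> g a r <= y) -> S a <= y.
  move=> al h; apply: sup_le_ub; first by have [] := supW a al.
  by move=> _ [r hr <-]; exact: h.
have SC e : 0 < e -> exists2 d, 0 < d & forall a b, lo <= a <= hi -> lo <= b <= hi ->
    `|a - b| < d -> S a <= S b + e.
  move=> e0; have [d d0 hd] := gC e e0; exists d => // a b al bl ab.
  apply: S_le => // r hr.
  have [n [s [s0 rE]]] := @scale_up a r0 r ltac:(lra) hr.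
  have ar0 : 0 < a * r0 by apply: mulr_gt0; lra.
  have sr0 : 0 < s <= r0 by lra.
  rewrite rE; have [_ ->] := @scale_invariant_iter a r0 (g a) n s ltac:(lra)
    (fun r h => gP a r al h) sr0.
  apply: (le_trans (hd a b s al bl ab _)).
    have : lo * r0 <= a * r0 by rewrite ler_pM2r; lra.
    by lra.
  by rewrite lerD2r S_ge.
(* Clamping extends the supremum to a continuous function on the whole line. *)
pose clamp a := Num.max lo (Num.min a hi).
have clampP a : lo <= clamp a <= hi.
  by rewrite /clamp le_max lexx /= ge_max lohi ge_min lexx orbT.
have clamp_lip a b : `|clamp a - clamp b| <= `|a - b|.
  have max_lip x y : `|Num.max lo x - Num.max lo y| <= `|x - y|.
    have h1 := ler_norm (x - y); have h2 := ler_norm (y - x); rewrite distrC in h2.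
    clear -h1 h2; rewrite ler_norml.
    by case: (leP lo x) => ?; case: (leP lo y) => ?; lra.
  have min_lip x y : `|Num.min x hi - Num.min y hi| <= `|x - y|.
    have h1 := ler_norm (x - y); have h2 := ler_norm (y - x); rewrite distrC in h2.
    clear -h1 h2; rewrite ler_norml.
    by case: (leP x hi) => ?; case: (leP y hi) => ?; lra.
  exact: le_trans (max_lip _ _) (min_lip _ _).
have Scont : continuous (S \o clamp).
  move=> a; apply/cvgrPdist_le => e e0; have [d d0 hd] := SC e e0.
  near=> b; rewrite /=.
  have ab : `|a - b| < d by near: b; exact: cvgr_dist_lt.
  have h1 := hd _ _ (clampP a) (clampP b) (le_lt_trans (clamp_lip a b) ab).
  rewrite distrC in ab.
  have h2 := hd _ _ (clampP b) (clampP a) (le_lt_trans (clamp_lip b a) ab).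
  by rewrite ler_norml; lra.
have clo : clamp lo = lo by rewrite /clamp (min_idPl lohi) maxxx.
have chi : clamp hi = hi by rewrite /clamp minxx (max_idPr lohi).
have lo_in : lo <= lo <= hi by rewrite lexx.
have hi_in : lo <= hi <= hi by rewrite lexx andbT.
have [c _ Sc] : exists2 c, c \in `[lo, hi] & (S \o clamp) c = v.
  apply: IVT => //; first by apply: continuous_subspaceT.
  rewrite /= clo chi ge_min le_max.
  case: gE => -[].
    move=> [r hr vr] h; have := S_le hi v hi_in h; have := S_ge lo r lo_in hr.
    by move=> h1 h2; apply/andP; split; apply/orP; [right|left]; lra.
  move=> h [r hr vr]; have := S_le lo v lo_in h; have := S_ge hi r hi_in hr.
  by move=> h1 h2; apply/andP; split; apply/orP; [left|right]; lra.
have al := clampP c; exists (clamp c) => //; rewrite -Sc.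
apply: (@limf_esup_scale_invariant (clamp c) r0) => //.
- by lra.
- by move=> r; exact: gP.
- by move=> r; exact: S_ge.
- move=> e e0; have [_ [r hr <-] hS] := sup_adherent e0 (supW _ al).
  by exists r.
Unshelve. all: by end_near.
Qed.
End ScaleInvariant.

(** * Asymptotic determinism *)

Section Determinism.
Variable R : realType.
Implicit Types (a b d r : R) (k n : nat) (mu nu : probability (measurableTypeR R) R).

Lemma det_infty_near (lo rho e : R) : 1 / 4 <= lo -> 0 < rho -> 0 < e ->
  exists2 d, 0 < d & forall a b mu nu r, lo <= a < 1 / 2 -> lo <= b < 1 / 2 ->
    cylinder_uniform a mu -> cylinder_uniform b nu -> `|a - b| < d -> rho <= r ->
    det_infty a mu r <= det_infty b nu r + e.
Proof.
move=> lo4 rho0 e0; have [K hK] := @expr_lt_eps R (1 / 2) rho ltac:(lra) rho0.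
have K0 : 0 < (2 ^+ K)^-1 :> R by rewrite invr_gt0 exprn_gt0.
(* 12 = 6 + 6: numerator and denominator each move by at most 6 / 2^k, and the denominator is at
   least 2^-K since r >= rho. *)
have [k hk] := @expr_lt_eps R (1 / 2) (e * (2 ^+ K)^-1 / 12) ltac:(lra)
  ltac:(by apply: divr_gt0 => //; apply: mulr_gt0).
rewrite expr_div_n expr1n div1r in hk.
exists ((1 / 4) ^+ k / 4); first by apply: divr_gt0 => //; apply: exprn_gt0; lra.
move=> a b mu nu r al bl hmu hnu ab rhor.
have a0 : 0 < a < 1 / 2 by lra. have b0 : 0 < b < 1 / 2 by lra.
have r0 : 0 < r by lra.
have ba : `|b - a| < (1 / 4) ^+ k / 4 by rewrite distrC.
have near1 : 4 * `|a - b| <= (1 / 4) ^+ k by lra.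
have near2 : 4 * `|b - a| <= (1 / 4) ^+ k by lra.
have al' : 1 / 4 <= a < 1 / 2 by lra.
have bl' : 1 / 4 <= b < 1 / 2 by lra.
have aK : a ^+ K <= r.
  have : a ^+ K <= (1 / 2) ^+ K by apply: lerXn2r; rewrite ?nnegrE; lra.
  by lra.
have [_ y1] := corr_near r al' bl' hmu hnu near1.
have [x1 _] := corr_near r bl' al' hnu hmu near2.
have yK := corry_ge a0 hmu aK; have yx := corry_le_corr1 a0 hmu r.
have y0 := corry_gt0 b0 hnu r0; have yx' := corry_le_corr1 b0 hnu r.
rewrite /det_infty; move: y1 x1 yK yx y0 yx'.
move: (corr a mu +oo%E r) (corr b nu +oo%E r) (corr a mu 1%E r) (corr b nu 1%E r).
move: (2 ^+ K)^-1 (2 ^+ k)^-1 K0 hk => c w c0 cw y y' x x' h1 h2 h3 h4 h5 h6.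
clear -e0 c0 cw h1 h2 h3 h4 h5 h6; have x0 : 0 < x by lra.
rewrite ler_pdivrMr//; set q := y' / x'.
have q1 : 0 <= q <= 1 by rewrite /q divr_ge0 ?ler_pdivrMr ?mul1r; lra.
have qE : y' = q * x' by rewrite /q divfK//; lra.
have w0 : 0 < w \/ w <= 0 by case: (ltP 0 w); [left|right].
have : e * c <= e * x by rewrite ler_pM2l; lra.
have : q * x' <= q * (x + 6 * w) by apply: ler_wpM2l; lra.
by case: w0 => w0; nra.
Qed.

Lemma scaled_ratio_le (A C c d x y : R) i j : 0 <= d -> 0 < x ->
  y = c / 2 ^+ (i + j) -> A / 2 ^+ j <= C -> C / 2 ^+ i <= x -> c <= d * A ->
  y / x <= d.
Proof.
move=> d0 x0 -> AC Cx cA; rewrite ler_pdivrMr// exprD mulrC invfM.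
have : A / 2 ^+ j / 2 ^+ i <= x.
  by apply: le_trans Cx; apply: ler_wpM2r => //; rewrite invr_ge0 exprn_ge0.
move=> /(ler_wpM2l d0); apply: le_trans.
have i0 : 0 <= (2 ^+ i)^-1 :> R by rewrite invr_ge0 exprn_ge0.
have j0 : 0 <= (2 ^+ j)^-1 :> R by rewrite invr_ge0 exprn_ge0.
have := ler_wpM2r (mulr_ge0 i0 j0) cA.
by move: (2 ^+ i)^-1 (2 ^+ j)^-1 => u v; lra.
Qed.

Lemma expr_quarter n : (1 / 4) ^+ n = (2 ^- n) ^+ 2 :> R.
Proof.
have -> : 1 / 4 = 2 ^- 2 :> R by field.
by rewrite !exprVn -!exprM; congr ((_ ^+ _)^-1); lia.
Qed.

(** Write r = b^m s with s in [b, 1], taking scale 1 rather than 1 - 2b as reference. The claim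
    becomes s + 4x^2 <= d(2s - 13x), which follows from s >= 1/4 and 4x^2 + 13dx <= 17x. *)
Lemma det_half_minus_le n d mu r : (1 < n)%N -> cylinder_uniform (half_minus R n) mu ->
  d <= 1 -> 17 * 2 ^- n <= (2 * d - 1) / 4 ->
  0 < r <= 1 - 2 * half_minus R n -> det_infty (half_minus R n) mu r <= d.
Proof.
move=> n1 + d1; have := expV2n_range R n1; have := half_minus_range R n1.
have := half_minusE R n; set b := half_minus R n; set x : R := 2 ^- n.
move=> bE b1 xr hmu xd rr; have b0 : 0 < b < 1 / 2 by lra.
have [m [s [sr rE]]] := @scale_up R b 1 r ltac:(lra) ltac:(lra).
have bm0 i : 0 < b ^+ i by apply: exprn_gt0; lra.
(* Here r <= 1 - 2b = x^4 / 2 < x^2 = (1/4)^n <= b^n, so at least n factors b are available. *)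
have nm : (n <= m)%N.
  rewrite leqNgt; apply/negP => mn.
  have h1 : b ^+ n <= b ^+ m.+1 by apply: ler_wiXn2l => //; lra.
  have h2 : b ^+ m.+1 <= r by rewrite rE exprSr ler_pM2l ?bm0//; lra.
  have h3 : (1 / 4) ^+ n <= b ^+ n by apply: lerXn2r; rewrite ?nnegrE; lra.
  have h4 : (1 / 4) ^+ n = x ^+ 2 by exact: expr_quarter.
  have : x ^+ 4 <= x ^+ 2 * 1.
    rewrite (_ : 4%N = (2 + 2)%N)// exprD ler_wpM2l ?sqr_ge0//.
    by apply: exprn_ile1; lra.
  have : 0 < x ^+ 2 by apply: exprn_gt0; lra.
  by lra.
have s1 : 1 / 4 <= s <= 1 by lra. have s01 : 0 <= s <= 1 by lra.
have r0 : 0 < r by lra. have d0 : 0 <= d by lra.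
have [hy h1] := corr_half_minus n1 hmu s1.
have h2 := corr1_scale_iter_ge b0 hmu (m - n) (b ^+ n * s).
rewrite mulrA -exprD subnK// -rE -/b in h2.
have h3 := corry_scale_iter b0 hmu m s01.
rewrite -rE in h3.
have c0 := lt_le_trans (corry_gt0 b0 hmu r0) (corry_le_corr1 b0 hmu r).
rewrite -(subnK nm) in h3; apply: (scaled_ratio_le d0 c0 h3 h1 h2).
apply: (le_trans hy); clear -xr d1 xd s1.
have : 0 <= (2 * d - 1) * (s - 1 / 4) by apply: mulr_ge0; lra.
have : x ^+ 2 <= x * (1 / 4) by rewrite expr2 ler_pM2l; lra.
have : 0 <= x * (1 - d) by apply: mulr_ge0; lra.
rewrite -/x; lra.
Qed.

(** The scales are b^i times 3/4, since 3/4 < 1 - b^2 keeps c_infty(3/4) at most 1/2 while c_1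
    scales from about 3/2. *)
Lemma det_half_minus_ex n d mu r0 : (1 < n)%N ->
  cylinder_uniform (half_minus R n) mu -> 1 / 3 < d <= 1 ->
  13 * 2 ^- n <= (3 * d - 1) / 2 -> 0 < r0 ->
  exists2 r, 0 < r <= r0 & det_infty (half_minus R n) mu r <= d.
Proof.
move=> n1 + d1; have := expV2n_range R n1; have := half_minus_range R n1.
set b := half_minus R n; set x : R := 2 ^- n.
move=> b1 xr hmu xd r00; have b0 : 0 < b < 1 / 2 by lra.
have [m hm] := @expr_lt_eps R b r0 ltac:(lra) r00.
have bm0 i : 0 < b ^+ i by apply: exprn_gt0; lra.
have rr : 0 < b ^+ (m + n) * (3 / 4) <= r0.
  apply/andP; split; first by apply: mulr_gt0 => //; lra.
  have : b ^+ (m + n) <= b ^+ m by apply: ler_wiXn2l; [lra|lra|exact: leq_addr].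
  by have := bm0 (m + n)%N; lra.
exists (b ^+ (m + n) * (3 / 4)) => //.
have r0' : 0 < b ^+ (m + n) * (3 / 4) by case/andP: rr.
have d0 : 0 <= d by lra. have b34 : 3 / 4 < 1 - b ^+ 2 by rewrite expr2; nra.
have [_ h1] := corr_half_minus n1 hmu (ltac:(lra) : 1 / 4 <= (3 / 4 : R) <= 1).
have h2 := corr1_scale_iter_ge b0 hmu m (b ^+ n * (3 / 4)).
rewrite mulrA -exprD -/b in h2.
have h3 := corry_scale_iter b0 hmu (m + n) (ltac:(clear; lra) : 0 <= (3 / 4 : R) <= 1).
have hy := @corry_le_half R b mu b0 hmu (3 / 4) b34.
have c0 := lt_le_trans (corry_gt0 b0 hmu r0') (corry_le_corr1 b0 hmu _).
apply: (scaled_ratio_le d0 c0 h3 h1 h2).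
apply: (le_trans hy); clear -xr d1 xd.
have : 0 <= x * (1 - d) by apply: mulr_ge0; lra.
rewrite -/x; lra.
Qed.

(** 1/3 lies in [a, 1 - 2a[ for a = 1/4, where c_1 <= 1/2 <= c_infty. *)
Lemma det_quarter_ge mu r0 : cylinder_uniform (1 / 4) mu -> 0 < r0 ->
  exists2 r, 0 < r <= r0 & 1 <= det_infty (1 / 4) mu r.
Proof.
move=> hmu r00; have q0 : 0 < (1 / 4 : R) < 1 / 2 by lra.
have [n hn] := @expr_lt_eps R (1 / 4) r0 ltac:(lra) r00.
have qn : 0 < (1 / 4) ^+ n :> R by apply: exprn_gt0; lra.
have sc s : 0 < s <= 1 / 3 -> det_infty (1 / 4) mu (1 / 4 * s) = det_infty (1 / 4) mu s.
  by move=> s3; apply: det_infty_scale => //; lra.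
have [_ e] := @scale_invariant_iter R (1 / 4) (1 / 3) (det_infty (1 / 4) mu) n (1 / 3)
  ltac:(lra) sc ltac:(lra).
exists ((1 / 4) ^+ n * (1 / 3)); first by clear sc e; lra.
rewrite e; have := @corry_ge_half R (1 / 4) mu q0 hmu (1 / 3) ltac:(clear sc e; lra).
have := @corr1_le_half R (1 / 4) mu q0 hmu (1 / 3) ltac:(clear sc e; lra).
have := corry_le_corr1 q0 hmu (1 / 3).
rewrite /det_infty; move: (corr _ _ _ _) (corr _ _ _ _) => y x; clear.
by move=> h1 h2 h3; rewrite ler_pdivlMr; lra.
Qed.

Lemma det_third_le a mu r : 0 < a <= 1 / 3 -> cylinder_uniform a mu -> 0 < r ->
  8 / 15 <= det_infty a mu r.
Proof.
move=> a3 hmu r0; have a0 : 0 < a < 1 / 2 by lra.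
have := @corr1_le_corry R a mu a0 hmu r ltac:(lra) ltac:(lra).
have := corry_gt0 a0 hmu r0; have := corry_le_corr1 a0 hmu r.
rewrite /det_infty; move: (corr _ _ _ _) (corr _ _ _ _) => y x; clear.
by move=> h1 h2 h3; rewrite ler_pdivlMr; lra.
Qed.

(* The sign [sg] lets one statement serve for the limsup and the liminf. *)
Lemma det_family_ivt (sg v : R) n (muf : R -> probability (measurableTypeR R) R) :
  sg = 1 \/ sg = -1 -> (1 < n)%N ->
  (forall a, 0 < a < 1 / 2 -> cylinder_uniform a (muf a)) ->
  let b := half_minus R n in
  let g a r := sg * det_infty a (muf a) r in
  (exists2 r, 0 < r <= 1 - 2 * b & v <= g (1 / 4) r) /\
    (forall r, 0 < r <= 1 - 2 * b -> g b r <= v) \/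
  (forall r, 0 < r <= 1 - 2 * b -> g (1 / 4) r <= v) /\
    (exists2 r, 0 < r <= 1 - 2 * b & v <= g b r) ->
  exists2 a, 1 / 4 <= a < 1 / 2 & limf_esup (fun r => (g a r)%:E) 0^'+ = v%:E.
Proof.
move=> sg1 n1 hmuf b g hv; have b1 : 1 / 4 <= b < 1 / 2 by exact: half_minus_range.
have in0 a : 1 / 4 <= a <= b -> 0 < a < 1 / 2 by lra.
have h0 : 0 < (1 / 4 : R) by clear; lra.
have [h1 h2 h3] : [/\ 1 / 4 <= b, b < 1 & 0 < 1 - 2 * b] by split; clear -b1; lra.
have [a ab aE] : exists2 a, 1 / 4 <= a <= b & limf_esup (fun r => (g a r)%:E) 0^'+ = v%:E.
  apply: (scale_invariant_family_ivt h0 h1 h2 h3 _ _ _ hv).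
  (* For all a <= b, 1 - 2b <= 1 - 2a, so ]0, 1 - 2b] is a common range of scale invariance. *)
  - move=> a r al rr; rewrite /g (det_infty_scale (in0 a al) (hmuf _ (in0 a al)))//.
    have : a * r <= 1 / 2 * r by rewrite ler_pM2r; lra.
    lra.
  - move=> a r al /andP[r0 _].
    have := det_infty_range (in0 a al) (hmuf _ (in0 a al)) r0.
    rewrite /g; move: (det_infty _ _ _) => y; clear -sg1.
    by case: sg1 => ->; rewrite ?mul1r ?mulN1r ?normrN => y01; rewrite ger0_norm; lra.
  - move=> e e0.
    have [d d0 hd] := @det_infty_near (1 / 4) (1 / 4 * (1 - 2 * b)) e ltac:(lra) ltac:(lra) e0.
    exists d => // a1 a2 r al1 al2 a12 /andP[rr _].
    have al1' : 1 / 4 <= a1 < 1 / 2 by lra. have al2' : 1 / 4 <= a2 < 1 / 2 by lra.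
    have ml1 := hmuf _ (in0 _ al1); have ml2 := hmuf _ (in0 _ al2).
    have a21 : `|a2 - a1| < d by rewrite distrC.
    have := hd _ _ _ _ r al1' al2' ml1 ml2 a12 rr.
    have := hd _ _ _ _ r al2' al1' ml2 ml1 a21 rr.
    rewrite /g; move: (det_infty _ _ _) (det_infty _ _ _) => y z; clear -sg1.
    by case: sg1 => ->; lra.
by exists a => //; lra.
Qed.

Lemma expV2n_small (e : R) : 0 < e -> exists2 n, (1 < n)%N & 2 ^- n <= e.
Proof.
move=> e0; have [n hn] := @expr_lt_eps R (1 / 2) e ltac:(lra) e0.
exists n.+2 => //; rewrite expr_div_n expr1n div1r in hn.
apply: le_trans (ltW hn); rewrite !exprS !invfM.
have : 0 < (2 ^+ n)^-1 :> R by rewrite invr_gt0 exprn_gt0.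
by move: (2 ^+ n)^-1 => w w0; lra.
Qed.
End Determinism.

Theorem corollary32 (R : realType) (dsup dinf : R)
    (hdsup : 1 / 2 < dsup <= 1) (hdinf : 1 / 3 < dinf <= 8 / 15) :
  exists asup ainf : R,
    [/\ 0 < asup < 1 / 2,
        0 < ainf < 1 / 2,
        exists2 mu : probability (measurableTypeR R) R,
          cylinder_uniform asup mu &
          limf_esup (fun r => (det_infty asup mu r)%:E) 0^'+ = dsup%:E &
        exists2 mu : probability (measurableTypeR R) R,
          cylinder_uniform ainf mu &
          limf_einf (fun r => (det_infty ainf mu r)%:E) 0^'+ = dinf%:E].
Proof.
have /choice[muf hmuf] : forall a : R, exists mu : probability (measurableTypeR R) R,
    0 < a < 1 / 2 -> cylinder_uniform a mu.
  move=> a.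
  have [a0|a0] := pselect (0 < a < 1 / 2).
    by have [mu hmu] := cylinder_uniform_exists a0; exists mu.
  have [mu _] := @cylinder_uniform_exists R (1 / 4) ltac:(lra).
  by exists mu => a0'; case: a0.
have q0 : 0 < (1 / 4 : R) < 1 / 2 by lra.
have [asup asupr supE] : exists2 a, 1 / 4 <= a < 1 / 2 &
    limf_esup (fun r => (det_infty a (muf a) r)%:E) 0^'+ = dsup%:E.
  (* 68 = 4 * 17, the smallness required by [det_half_minus_le]. *)
  have [n n1 nx] := @expV2n_small R ((2 * dsup - 1) / 68) ltac:(lra).
  have b0 := half_minus_range R n1.
  have [|a al aE] := @det_family_ivt R 1 dsup n muf (or_introl erefl) n1 hmuf.
    left; split.
      have [r rr hr] := @det_quarter_ge R (muf (1 / 4)) (1 - 2 * half_minus R n)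
        (hmuf _ q0) ltac:(lra).
      by exists r => //; rewrite mul1r; apply: le_trans hr; case/andP: hdsup.
    move=> r rr; rewrite mul1r.
    by apply: det_half_minus_le => //; [apply: hmuf; lra|lra|lra].
  by exists a => //; rewrite -aE; congr limf_esup; apply/funext => r; rewrite mul1r.
have [ainf ainfr infE] : exists2 a, 1 / 4 <= a < 1 / 2 &
    limf_esup (fun r => (-1 * det_infty a (muf a) r)%:E) 0^'+ = (- dinf)%:E.
  (* 26 = 2 * 13, the smallness required by [det_half_minus_ex]. *)
  have [n n1 nx] := @expV2n_small R ((3 * dinf - 1) / 26) ltac:(lra).
  have b0 := half_minus_range R n1.
  apply: (@det_family_ivt R (-1) (- dinf) n muf (or_intror erefl) n1 hmuf).
  right; split.
    move=> r /andP[r0 _]; rewrite mulN1r lerN2.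
    apply: le_trans (_ : 8 / 15 <= _); first by case/andP: hdinf.
    by apply: det_third_le => //; [lra|exact: hmuf].
  have [b1 r0] : 0 < half_minus R n < 1 / 2 /\ 0 < 1 - 2 * half_minus R n.
    by clear -b0; split; lra.
  have d1 : 1 / 3 < dinf <= 1 by clear -hdinf; lra.
  have nx' : 13 * 2 ^- n <= (3 * dinf - 1) / 2 by clear -nx; lra.
  have [r rr hr] := det_half_minus_ex n1 (hmuf _ b1) d1 nx' r0.
  by exists r => //; rewrite mulN1r lerN2.
exists asup, ainf; split; [lra|lra| |].
  by exists (muf asup) => //; apply: hmuf; lra.
exists (muf ainf); first by apply: hmuf; lra.
transitivity (- limf_esup (fun r => (-1 * det_infty ainf (muf ainf) r)%:E) 0^'+)%E.
  rewrite /limf_einf; congr (- limf_esup _ _)%E.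
  by apply/funext => r; rewrite mulN1r EFinN.
by rewrite infE EFinN oppeK.
Qed.
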